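(* Assume that $h_0(x)=f(x|\mu_0,\Sigma_0)$ for some $(\mu_0,\Sigma_0)\in\Theta\times\Omega$, that $f$ is strongly identifiable in the second order, and that $f$ admits the uniform Lipschitz condition up to the second order (both defined in the context). For $G=(\lambda,\mu,\Sigma)$ and $G_*=(\lambda^*,\mu^*,\Sigma^* )$ in $\Xi$ denote $$\mathcal D(G,G_* )=\lambda\|(\Delta\mu,\Delta\Sigma)\|^2+\lambda^*\|(\Delta\mu^*,\Delta\Sigma^* )\|^2-\min\{\lambda,\lambda^*\}\big(\|(\Delta\mu,\Delta\Sigma)\|^2+\|(\Delta\mu^*,\Delta\Sigma^* )\|^2\big)$$ $$\qquad+\big(\lambda\|(\Delta\mu,\Delta\Sigma)\|+\lambda^*\|(\Delta\mu^*,\Delta\Sigma^* )\|\big)\,\|(\mu,\Sigma)-(\mu^*,\Sigma^* )\| .$$ Then there exists a positive constant $C$ depending only on $\Theta$, $\Omega$ and $(\mu_0,\Sigma_0)$ such that $V(p_G,p_{G_*})\ge C\,\mathcal D(G,G_* )$ for all $G,G_*\in\Xi$.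
   Context: Setting. $\Theta\subset\mathbb{R}^{d_1}$ and $\Omega\subset\mathbb{R}^{d_2\times d_2}$ are compact ($\Omega$ consisting of positive definite matrices); $\{f(\cdot|\mu,\Sigma):(\mu,\Sigma)\in\Theta\times\Omega\}$ is a fixed family of probability densities on $\mathcal X\subset\mathbb{R}^d$ with respect to Lebesgue measure. $\Xi=[0,1]\times\Theta\times\Omega$, and for $G=(\lambda,\mu,\Sigma)\in\Xi$, $p_G(x)=(1-\lambda)h_0(x)+\lambda f(x|\mu,\Sigma)$. $V(p,q)=\frac12\int|p-q|\,dx$. $\Delta\mu=\mu-\mu_0$, $\Delta\Sigma=\Sigma-\Sigma_0$, $\Delta\mu^*=\mu^*-\mu_0$, $\Delta\Sigma^*=\Sigma^*-\Sigma_0$. $\|(\mu,\Sigma)\|$ is the Euclidean norm on $\mathbb{R}^{d_1}\times\mathbb{R}^{d_2\times d_2}$. Strong identifiability in the second order: $f$ is twice differentiable in $(\mu,\Sigma)$ and, for any positive integer $k$ and any $k$ distinct pairs $(\mu_1,\Sigma_1),\dots,(\mu_k,\Sigma_k)$, if real coefficients $\alpha^{(i)}_\eta$ (with $\eta=(\eta_1,\eta_2)\in\mathbb{N}^{d_1}\times\mathbb{N}^{d_2\times d_2}$) satisfy $\sum_{\ell=0}^2\sum_{|\eta|=\ell}\sum_{i=1}^k\alpha_\eta^{(i)}\frac{\partial^{|\eta|}f}{\partial\mu^{\eta_1}\partial\Sigma^{\eta_2}}(x|\mu_i,\Sigma_i)=0$ for almost all $x\in\mathcal X$, then $\alpha^{(i)}_\eta=0$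 for all $i\in\{1,\dots,k\}$ and $|\eta|\le2$. Second-order uniform Lipschitz: there are $\delta_3,\delta_4>0$ such that for any $R_4,R_5,R_6>0$ there are positive constants $C_1$ depending on $(R_4,R_5)$ and $C_2$ depending on $R_6$ such that for all $\gamma_1\in\mathbb{R}^{d_1}$, $\gamma_2\in\mathbb{R}^{d_2\times d_2}$, all $\Sigma\in\Omega$ whose smallest and largest eigenvalues have square roots in $[R_4,R_5]$, all $\mu\in\Theta$ with $\|\mu\|\le R_6$, all $\mu_1,\mu_2\in\Theta$, $\Sigma_1,\Sigma_2\in\Omega$ and all $x\in\mathcal X$, $$\Big|\gamma_1^\top\Big(\tfrac{\partial^2f}{\partial\mu^2}(x|\mu_1,\Sigma)-\tfrac{\partial^2f}{\partial\mu^2}(x|\mu_2,\Sigma)\Big)\gamma_1\Big|\le C_1\|\mu_1-\mu_2\|_1^{\delta_3}\|\gamma_1\|_2^2,$$ $$\Big|\mathrm{tr}\Big(\Big[\tfrac{\partial}{\partial\Sigma}\mathrm{tr}\Big(\tfrac{\partial f}{\partial\Sigma}(x|\mu,\Sigma_1)^\top\gamma_2\Big)-\tfrac{\partial}{\partial\Sigma}\mathrm{tr}\Big(\tfrac{\partial f}{\partial\Sigma}(x|\mu,\Sigma_2)^\top\gamma_2\Big)\Big]^\top\gamma_2\Big)\Big|\le C_2\|\Sigma_1-\Sigma_2\|_2^{\delta_4}\|\gamma_2\|_2^2 .$$ *)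

(* Defs.v *)
From HB Require Import structures.
From mathcomp Require Import all_boot all_order all_algebra.
From mathcomp Require Import all_classical all_reals all_analysis.

Set Implicit Arguments.
Unset Strict Implicit.
Unset Printing Implicit Defensive.

Import Order.TTheory GRing.Theory Num.Theory.
Import numFieldNormedType.Exports.

Local Open Scope classical_set_scope.
Local Open Scope ring_scope.

Section LebesgueRd.
Context {R : realType}.

(* R^d with its Borel (= product) sigma-algebra. *)
Definition Rd (d : nat) := d.-tuple (measurableTypeR R).

Definition cons_pair d (p : Rd d * measurableTypeR R) : Rd d.+1 :=
  [tuple of p.2 :: p.1].

Lemma measurable_cons_pair d : measurable_fun [set: _] (@cons_pair d).
Proof. exact: measurable_cons. Qed.

(* The factor [lebesgue_measure] is put second in the product because [\x] only
   asks its second argument to be sigma-finite. *)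
Definition lebesgue_step d (m : {measure set (Rd d) -> \bar R}) :
    set (Rd d.+1) -> \bar R :=
  pushforward (m \x @lebesgue_measure R)%E (@cons_pair d).

Section lebesgue_step_measure.
Variables (d : nat) (m : {measure set (Rd d) -> \bar R}).

(* The measure structure of [pushforward] is not inferred here: it needs the
   proof of measurability of [cons_pair]. *)
Let push := measure_function_pushforward__canonical__measure_function_Measure
  (m \x @lebesgue_measure R)%E (@measurable_cons_pair d).

Let step0 : lebesgue_step m set0 = 0%E.
Proof. exact: (measure0 push). Qed.

Let step_ge0 A : (0 <= lebesgue_step m A)%E.
Proof. exact: (measure_ge0 push). Qed.

Let step_sigma_additive : semi_sigma_additive (lebesgue_step m).
Proof. exact: (@measure_semi_sigma_additive _ _ _ push). Qed.

HB.instance Definition _ := isMeasure.Build _ _ _ (lebesgue_step m)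
  step0 step_ge0 step_sigma_additive.

End lebesgue_step_measure.

Fixpoint lebesgue_Rd (d : nat) : {measure set (Rd d) -> \bar R} :=
  match d with
  | 0 => @dirac _ (Rd 0) [tuple] R
  | d'.+1 => lebesgue_step (lebesgue_Rd d')
  end.

Lemma lebesgue_Rd_box d (A : 'I_d -> set (measurableTypeR R)) :
  (forall i, measurable (A i)) ->
  lebesgue_Rd d [set x | forall i, A i (tnth x i)] =
  (\prod_(i < d) lebesgue_measure (A i))%E.
Proof.
elim: d A => [|d IH] A mA.
  rewrite big_ord0 /= diracE mem_set//; by case.
rewrite big_ord_recl /= /lebesgue_step /pushforward.
rewrite (_ : _ @^-1` _ =
    [set x : Rd d | forall i, A (lift ord0 i) (tnth x i)] `*` A ord0); last first.
  apply/seteqP; split => -[x y] /= H.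
    split; last by have := H ord0.
    by move=> i; have := H (lift ord0 i); rewrite tnthS.
  case: H => H0 H1 i; case: (unliftP ord0 i) => [j|] ->; last by [].
  by rewrite tnthS.
rewrite product_measure1E //.
  by rewrite (IH (fun i => A (lift ord0 i))) // muleC.
rewrite (_ : [set x | _] =
    \bigcap_(i in [set: 'I_d])
      ((fun x : Rd d => tnth x i) @^-1` A (lift ord0 i))).
  apply: fin_bigcap_measurable => // i _.
  by rewrite -[X in measurable X]setTI; exact: (measurable_tnth i).
by apply/seteqP; split => x /= H i; [move=> _|]; exact: H.
Qed.

End LebesgueRd.

Arguments Rd : clear implicits.
Arguments lebesgue_Rd : clear implicits.

Section DeviatedMixture.
Context {R : realType} {d d1 d2 : nat}.

(* Parameters (mu, Sigma), and families of functions f x (mu, Sigma).  Such a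
   family is total in (mu, Sigma), so that it can be differentiated at the points
   of Theta `*` Omega, a set with empty interior when 1 < d2; only its germs
   around Theta `*` Omega are ever constrained. *)
Let param := ('cV[R]_d1 * 'M[R]_d2)%type.
Let family := Rd R d -> param -> R.

Definition normE {m n} (A : 'M[R]_(m, n)) : R :=
  Num.sqrt (\sum_i \sum_j A i j ^+ 2).

Definition norm1 (v : 'cV[R]_d1) : R := \sum_i `|v i 0|.

Definition normP (t : param) : R := Num.sqrt (normE t.1 ^+ 2 + normE t.2 ^+ 2).

Definition posdef (S : 'M[R]_d2) : Prop :=
  S^T = S /\ forall v : 'cV[R]_d2, v != 0 -> 0 < (v^T *m S *m v) 0 0.

Definition smallest_eigenvalue (S : 'M[R]_d2) (a : R) : Prop :=
  eigenvalue S a /\ forall b, eigenvalue S b -> a <= b.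

Definition largest_eigenvalue (S : 'M[R]_d2) (a : R) : Prop :=
  eigenvalue S a /\ forall b, eigenvalue S b -> b <= a.

Definition is_density (X : set (Rd R d)) (p : Rd R d -> R) : Prop :=
  [/\ measurable_fun X p, forall x, X x -> 0 <= p x &
      (\int[lebesgue_Rd R d]_(x in X) (p x)%:E = 1)%E].

(* Total variation distance. *)
Definition V (X : set (Rd R d)) (p q : Rd R d -> R) : \bar R :=
  ((2^-1)%:E * \int[lebesgue_Rd R d]_(x in X) `|p x - q x|%:E)%E.

Definition dmu (i : 'I_d1) (g : param -> R) (t : param) : R :=
  'D_((delta_mx i 0, 0) : param) g t.

Definition dSigma (i j : 'I_d2) (g : param -> R) (t : param) : R :=
  'D_((0, delta_mx i j) : param) g t.

Definition hess_mu (g : param -> R) (t : param) : 'M[R]_d1 :=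
  \matrix_(i, j) dmu i (dmu j g) t.

Definition grad_Sigma (g : param -> R) (t : param) : 'M[R]_d2 :=
  \matrix_(i, j) dSigma i j g t.

(* Frechet differentiability near t, and Frechet differentiability at t of the
   derivative, the latter expressed on all its components. *)
Definition twice_differentiable (g : param -> R) (t : param) : Prop :=
  (\forall s \near t, differentiable g s) /\
  forall v : param, differentiable (fun s => 'D_v g s) t.

(* Multi-indices (eta1, eta2); all entries of a multi-index of order at most 2
   are at most 2, hence the values in 'I_3, which make this a finite type. *)
Definition multi_index := ('cV['I_3]_d1 * 'M['I_3]_d2)%type.

Definition order_mi (eta : multi_index) : nat :=
  (\sum_i eta.1 i ord0 + \sum_i \sum_j eta.2 i j)%N.

Definition partial (eta : multi_index) (g : param -> R) : param -> R :=
  foldr (fun i => iter (eta.1 i ord0) (dmu i))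
    (foldr (fun ij => iter (eta.2 ij.1 ij.2) (dSigma ij.1 ij.2)) g
       (enum {: 'I_d2 * 'I_d2}))
    (enum 'I_d1).

Definition strongly_identifiable2 (X : set (Rd R d))
    (Theta : set 'cV[R]_d1) (Omega : set 'M[R]_d2) (f : family) : Prop :=
  (forall x t, X x -> (Theta `*` Omega) t -> twice_differentiable (f x) t) /\
  forall (k : nat) (t : 'I_k -> param) (alpha : 'I_k -> multi_index -> R),
    (0 < k)%N -> injective t -> (forall i, (Theta `*` Omega) (t i)) ->
    {ae lebesgue_Rd R d, forall x, X x ->
      \sum_(l < 3) \sum_(eta | order_mi eta == l) \sum_(i < k)
        alpha i eta * partial eta (f x) (t i) = 0} ->
    forall i eta, (order_mi eta <= 2)%N -> alpha i eta = 0.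

Definition uniform_lipschitz2 (X : set (Rd R d))
    (Theta : set 'cV[R]_d1) (Omega : set 'M[R]_d2) (f : family) : Prop :=
  exists delta3 delta4 : R, 0 < delta3 /\ 0 < delta4 /\
  exists (C1 : R -> R -> R) (C2 : R -> R),
  forall R4 R5 R6 : R, 0 < R4 -> 0 < R5 -> 0 < R6 ->
  0 < C1 R4 R5 /\ 0 < C2 R6 /\
  forall (gamma1 : 'cV[R]_d1) (gamma2 : 'M[R]_d2)
    (mu mu1 mu2 : 'cV[R]_d1) (Sigma Sigma1 Sigma2 : 'M[R]_d2) (x : Rd R d),
  Omega Sigma ->
  (forall a, smallest_eigenvalue Sigma a -> R4 <= Num.sqrt a <= R5) ->
  (forall a, largest_eigenvalue Sigma a -> R4 <= Num.sqrt a <= R5) ->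
  Theta mu -> normE mu <= R6 ->
  Theta mu1 -> Theta mu2 -> Omega Sigma1 -> Omega Sigma2 -> X x ->
  `| (gamma1^T *m (hess_mu (f x) (mu1, Sigma) - hess_mu (f x) (mu2, Sigma))
        *m gamma1) 0 0 |
    <= C1 R4 R5 * norm1 (mu1 - mu2) `^ delta3 * normE gamma1 ^+ 2 /\
  let h t := \tr ((grad_Sigma (f x) t)^T *m gamma2) in
  `| \tr ((grad_Sigma h (mu, Sigma1) - grad_Sigma h (mu, Sigma2))^T *m gamma2) |
    <= C2 R6 * normE (Sigma1 - Sigma2) `^ delta4 * normE gamma2 ^+ 2.

Definition Xi (Theta : set 'cV[R]_d1) (Omega : set 'M[R]_d2) : set (R * param) :=
  [set G | 0 <= G.1 <= 1 /\ (Theta `*` Omega) G.2].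

Definition mixture (h0 : Rd R d -> R) (f : family) (G : R * param) :
    Rd R d -> R :=
  fun x => (1 - G.1) * h0 x + G.1 * f x G.2.

Definition discrepancy (t0 : param) (G Gs : R * param) : R :=
  let r := normP (G.2 - t0) in
  let rs := normP (Gs.2 - t0) in
  G.1 * r ^+ 2 + Gs.1 * rs ^+ 2 - Num.min G.1 Gs.1 * (r ^+ 2 + rs ^+ 2)
  + (G.1 * r + Gs.1 * rs) * normP (G.2 - Gs.2).

End DeviatedMixture.

(* Main.v *)
Require Import Defs.
From mathcomp Require Import all_boot all_order all_algebra.
From mathcomp Require Import all_classical all_reals all_analysis.
From mathcomp Require Import measurable_realfun ring lra.

Import Order.TTheory GRing.Theory Num.Theory.
Import numFieldNormedType.Exports.

Local Open Scope classical_set_scope.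
Local Open Scope ring_scope.

Set Implicit Arguments.
Unset Strict Implicit.
Unset Printing Implicit Defensive.

(** Write [t = t0 + a] and [t' = t0 + b], where [t0 = (mu0, Sigma0)].  On the
    support,
      [p_G - p_G' = lambda (f(t) - f(t0)) - lambda' (f(t') - f(t0))].
    If no constant works, there are pairs [(G_n, G'_n)] whose total variation
    distance is at most [1/(n+1)] times their discrepancy; by compactness one may
    assume [t_n --> tau] and [t'_n --> tau'].  The contradiction comes from a
    Taylor expansion and Fatou's lemma.

    The abstract principle is [jets_lower_bound].  Suppose that [F_n] is, for
    each [x], a combination of the values and of the first and second partial
    derivatives of [f x] at fixed distinct points, with coefficients [c_n], up to
    an error small with respect to [sum |c_n|].  Then [\int |F_n|] cannot be small
    with respect to [sum |c_n|]: normalizing and extracting a convergent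
    subsequence of coefficients, Fatou's lemma ([fatou_family]) produces a
    nontrivial combination that vanishes almost everywhere, against strong
    identifiability ([jets_independent]).  Second derivatives occur only through
    symmetric coefficients, and because [f x] is twice differentiable its
    Hessian is symmetric ([hess_sym]), so that such a combination is determined
    by its multi-index coefficients.

    It remains to see that the discrepancy is at most a constant times
    [sum |c_n|].  When [tau] and [tau'] are not both [t0], an expansion to the
    first order around the two or three limit points is enough
    ([first_order_lower_bound]).  When [tau = tau' = t0], the coefficients of the
    second-order expansion at [t0] are, up to a factor 1/2 in [M2], the moments
      [M1 = lambda a - lambda' b],
      [M2 = lambda a(x)a - lambda' b(x)b],
    and the crux is that they control the discrepancy ([disc_moments]):
    [lambda' b(x)(a - b) = M2 - M1(x)a] and [lambda a(x)(a - b) = M2 - M1(x)b]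
    bound the last term of the discrepancy, and, for [lambda <= lambda'],
    [(lambda' - lambda) b = lambda (a - b) - M1] bounds the first ones.  Finally
    the Taylor remainder [g] of [f x] at [t0] satisfies a bound on differences,
    [|g(a) - g(b)| <= eps (|a| + |b|) |a - b|] ([taylor2]), which is what makes
    the remainder of [p_G - p_G'] small with respect to the discrepancy itself
    ([disc_remainder]).

    Segments between two parameters may leave the parameter set; the expansions
    hold along them because each [f x] is differentiable on an ambient
    neighbourhood of the limit points. *)

(** * Entries of parameters and differential calculus *)

Section Coordinates.
Context {R : realType} {d1 d2 : nat}.
Local Notation param := ('cV[R]_d1 * 'M[R]_d2)%type.
Local Notation idx := ('I_d1 + 'I_d2 * 'I_d2)%type.

Definition dir (j : idx) : param :=
  match j with
  | inl i => (delta_mx i 0, 0)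
  | inr ij => (0, delta_mx ij.1 ij.2)
  end.

Definition entry (j : idx) (v : param) : R :=
  match j with
  | inl i => v.1 i 0
  | inr ij => v.2 ij.1 ij.2
  end.

(** All parameters are measured in the l1 norm of their entries: it dominates the
    Euclidean norm, and is multiplicative on tensor products ([l1_tensor]). *)
Definition l1 (v : param) : R := \sum_j `|entry j v|.

Lemma entryD j u v : entry j (u + v) = entry j u + entry j v.
Proof. by case: j => [i|[i k]]; rewrite /= mxE. Qed.

Lemma entryN j v : entry j (- v) = - entry j v.
Proof. by case: j => [i|[i k]]; rewrite /= mxE. Qed.

Lemma entryB j u v : entry j (u - v) = entry j u - entry j v.
Proof. by rewrite entryD entryN. Qed.

Lemma entryZ j a v : entry j (a *: v) = a * entry j v.
Proof. by case: j => [i|[i k]]; rewrite /= mxE. Qed.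

Lemma entry0 j : entry j 0 = 0.
Proof. by case: j => [i|[i k]]; rewrite /= mxE. Qed.

Lemma entry_sum j (I : Type) (r : seq I) (F : I -> param) :
  entry j (\sum_(i <- r) F i) = \sum_(i <- r) entry j (F i).
Proof. by apply: big_morph => [u v|]; rewrite ?entryD ?entry0. Qed.

Lemma entry_inj u v : (forall j, entry j u = entry j v) -> u = v.
Proof.
case: u v => [a A] [b B] uv; congr pair.
  by apply/matrixP => i k; rewrite !ord1; exact: (uv (inl i)).
by apply/matrixP => i k; exact: (uv (inr (i, k))).
Qed.

Lemma entry_dir j k : entry j (dir k) = (j == k)%:R.
Proof.
case: j k => [i|[i k]] [i'|[i' k']] /=; rewrite mxE ?eqxx ?andbT //.
Qed.

Lemma entry_decomp v : v = \sum_j entry j v *: dir j.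
Proof.
apply: entry_inj => k; rewrite entry_sum (bigD1 k) //= big1 ?addr0.
  by rewrite entryZ entry_dir eqxx mulr1.
by move=> j jk; rewrite entryZ entry_dir eq_sym (negbTE jk) mulr0.
Qed.

Lemma le_entry_norm j v : `|entry j v| <= `|v|.
Proof.
case: j => [i|[i k]] /=; rewrite prod_normE le_max; apply/orP; [left|right];
  rewrite /Num.Def.normr /= mx_normrE.
- exact: (le_bigmax _ (fun ij => `|v.1 ij.1 ij.2|) (i, 0)).
- exact: (le_bigmax _ (fun ij => `|v.2 ij.1 ij.2|) (i, k)).
Qed.

Lemma le_entry_l1 j v : `|entry j v| <= l1 v.
Proof. by rewrite /l1 (bigD1 j)//= lerDl sumr_ge0. Qed.

Lemma l1_ge0 v : 0 <= l1 v.
Proof. exact: sumr_ge0. Qed.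

Lemma le_norm_l1 v : `|v| <= l1 v.
Proof.
rewrite prod_normE ge_max /Num.Def.normr /= !mx_normrE; apply/andP; split;
  (apply: bigmax_le; first exact: l1_ge0).
  by move=> [i k] _; rewrite (ord1 k); exact: (le_entry_l1 (inl i)).
by move=> ij _; exact: (le_entry_l1 (inr ij)).
Qed.

Lemma le_l1D u v : l1 (u + v) <= l1 u + l1 v.
Proof.
by rewrite -big_split; apply: ler_sum => j _; rewrite entryD ler_normD.
Qed.

Lemma l1N v : l1 (- v) = l1 v.
Proof. by apply: eq_bigr => j _; rewrite entryN normrN. Qed.

Lemma l1Z a v : l1 (a *: v) = `|a| * l1 v.
Proof. by rewrite mulr_sumr; apply: eq_bigr => j _; rewrite entryZ normrM. Qed.

Lemma l1_le_norm v : l1 v <= #|{: idx}|%:R * `|v|.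
Proof.
rewrite mulr_natl -sumr_const; apply: ler_sum => j _; exact: le_entry_norm.
Qed.
End Coordinates.

Section Calculus.
Context {R : realType} {d1 d2 : nat}.
Local Notation param := ('cV[R]_d1 * 'M[R]_d2)%type.
Local Notation idx := ('I_d1 + 'I_d2 * 'I_d2)%type.
Implicit Types (g : param -> R) (t u v : param).

(** This turns statements about a function of the parameters into statements
    about a function of one real variable, to which the mean value theorem
    applies. *)
Lemma is_derive_line g t v (x : R) : differentiable g (t + x *: v) ->
  is_derive x 1 (fun y : R => g (t + y *: v)) ('D_v g (t + x *: v)).
Proof.
move=> dg.
have dl : is_diff x (fun y : R => t + y *: v) ( *:%R ^~ v).
  rewrite (_ : ( *:%R ^~ v) = 0 + ( *:%R ^~ v)); last by rewrite add0r.
  exact: is_diffD.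
have dc : is_diff x (g \o (fun y : R => t + y *: v))
    ('d g (t + x *: v) \o ( *:%R ^~ v)).
  by apply: is_diff_comp; exact/differentiableP.
have [ddc dcE] := dc.
apply: DeriveDef; first exact: diff_derivable.
by rewrite deriveE // dcE /= scale1r deriveE.
Qed.

Lemma derive_entry g t v : differentiable g t ->
  'D_v g t = \sum_j entry j v * 'D_(dir j) g t.
Proof.
move=> dg; rewrite deriveE // {1}(entry_decomp v) linear_sum /=.
by apply: eq_bigr => j _; rewrite linearZ /= deriveE.
Qed.

Lemma is_derive_quadratic (A B x : R) :
  is_derive x 1 (fun y : R => y * A + y ^+ 2 * B) (A + 2 * x * B).
Proof.
have -> : (fun y : R => y * A + y ^+ 2 * B) = horner (A *: 'X + B *: 'X^2).
  by apply/funext => y; rewrite hornerD !hornerZ hornerX hornerXn mulrC (mulrC B).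
apply: is_derive_eq.
by rewrite derivD !derivZ derivX derivXn !hornerE; ring.
Qed.

(** [hess g t u v] is the second derivative of [g] at [t] in the directions [u]
    (outer derivative) and [v] (inner derivative), written on the basis so that it
    is bilinear by construction. *)
Definition hess g t u v : R :=
  \sum_i \sum_j entry i u * entry j v * 'D_(dir i) ('D_(dir j) g) t.

(** Differentiability of the finitely many functions ['D_(dir j) g] at [t] gives an
    expansion of ['D_v g] that is uniform in the direction [v]. *)
Lemma derive_expansion g t : twice_differentiable g t ->
  forall eps : R, 0 < eps -> \forall h \near (0 : param),
    differentiable g (t + h) /\
    forall v, `|'D_v g (t + h) - 'D_v g t - hess g t h v| <= eps * l1 h * l1 v.
Proof.
move=> [dg ddg] eps eps0.
have dg_t : differentiable g t by exact: nbhs_singleton dg.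
have H j : \forall h \near (0 : param),
    `|'D_(dir j) g (t + h) - 'D_(dir j) g t
      - \sum_i entry i h * 'D_(dir i) ('D_(dir j) g) t| <= eps * l1 h.
  have := diff_locally (ddg (dir j)); move/eqaddoP => /(_ _ eps0).
  apply: filterS => h /=; rewrite -derive_entry // (deriveE _ (ddg _)).
  rewrite !fctE opprD addrA (addrC h t) => /le_trans; apply.
  by rewrite ler_pM2l // le_norm_l1.
have dgh : \forall h \near (0 : param), differentiable g (t + h).
  by move: dg; rewrite (near_shift 0 t); apply: filterS => h /=; rewrite subr0 addrC.
have HH : \forall h \near (0 : param), forall j, `|'D_(dir j) g (t + h) - 'D_(dir j) g t
      - \sum_i entry i h * 'D_(dir i) ('D_(dir j) g) t| <= eps * l1 h.
  exact: (@filter_forall _ _ _ (nbhs (0 : param)) _ H).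
near=> h; split; first by near: h.
have Hh : forall j, `|'D_(dir j) g (t + h) - 'D_(dir j) g t
      - \sum_i entry i h * 'D_(dir i) ('D_(dir j) g) t| <= eps * l1 h by near: h.
move=> v; rewrite derive_entry; last by near: h.
rewrite (derive_entry _ dg_t) /hess exchange_big /= -!sumrB.
rewrite mulr_sumr (le_trans (ler_norm_sum _ _ _))//; apply: ler_sum => j _.
have -> : entry j v * 'D_(dir j) g (t + h) - entry j v * 'D_(dir j) g t -
   \sum_i entry i h * entry j v * 'D_(dir i) ('D_(dir j) g) t
  = entry j v * ('D_(dir j) g (t + h) - 'D_(dir j) g t
      - \sum_i entry i h * 'D_(dir i) ('D_(dir j) g) t).
  rewrite !mulrBr mulr_sumr; congr (_ - _); apply: eq_bigr => i _.
  by rewrite mulrA (mulrC (entry j v)).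
rewrite normrM mulrC ler_wpM2r //.
Unshelve. all: by end_near.
Qed.

Lemma derive_expansion_l1 g t : twice_differentiable g t ->
  forall eps : R, 0 < eps -> exists2 delta : R, 0 < delta & forall h, l1 h < delta ->
    differentiable g (t + h) /\
    forall v, `|'D_v g (t + h) - 'D_v g t - hess g t h v| <= eps * l1 h * l1 v.
Proof.
move=> dg eps eps0; have /nbhs_normP[delta /= delta0 H] := derive_expansion dg eps0.
exists delta => // h hd; apply: H => /=.
by rewrite sub0r normrN (le_lt_trans (le_norm_l1 _)).
Qed.

Lemma hessDl g t u u' v : hess g t (u + u') v = hess g t u v + hess g t u' v.
Proof.
rewrite -big_split; apply: eq_bigr => i _; rewrite -big_split; apply: eq_bigr => j _.
by rewrite entryD /=; ring.
Qed.

Lemma hessDr g t u v v' : hess g t u (v + v') = hess g t u v + hess g t u v'.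
Proof.
rewrite -big_split; apply: eq_bigr => i _; rewrite -big_split; apply: eq_bigr => j _.
by rewrite entryD /=; ring.
Qed.

Lemma hessZl g t a u v : hess g t (a *: u) v = a * hess g t u v.
Proof.
rewrite mulr_sumr; apply: eq_bigr => i _; rewrite mulr_sumr; apply: eq_bigr => j _.
by rewrite entryZ; ring.
Qed.

Lemma hessZr g t a u v : hess g t u (a *: v) = a * hess g t u v.
Proof.
rewrite mulr_sumr; apply: eq_bigr => i _; rewrite mulr_sumr; apply: eq_bigr => j _.
by rewrite entryZ; ring.
Qed.

Lemma hessNl g t u v : hess g t (- u) v = - hess g t u v.
Proof. by rewrite -scaleN1r hessZl mulN1r. Qed.

Lemma hessNr g t u v : hess g t u (- v) = - hess g t u v.
Proof. by rewrite -scaleN1r hessZr mulN1r. Qed.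

Lemma MVT_unit (phi dphi : R -> R) :
  (forall x : R, 0 <= x <= 1 -> is_derive x 1 phi (dphi x)) ->
  exists2 x : R, 0 <= x <= 1 & phi 1 - phi 0 = dphi x.
Proof.
move=> dphiP.
have [|||x x01 ->] := @MVT_segment R phi dphi 0 1.
- exact: ler01.
- by move=> x; rewrite in_itv /= => /andP[x0 x1]; apply: dphiP; rewrite !ltW.
- apply: derivable_within_continuous => x; rewrite in_itv /= => x01.
  by have [] := dphiP x x01.
by exists x; rewrite ?subr0 ?mulr1.
Qed.

(** The mean value theorem applied to [y |-> g (t + u + y v) - g (t + y v)]
    expresses the second difference as an increment of ['D_v g] along [u]. *)
Lemma second_difference g t (eps delta : R) u v :
  (forall h, l1 h < delta -> differentiable g (t + h) /\
    forall v, `|'D_v g (t + h) - 'D_v g t - hess g t h v| <= eps * l1 h * l1 v) ->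
  0 < eps -> l1 u + l1 v < delta ->
  `|g (t + u + v) - g (t + u) - (g (t + v) - g t) - hess g t u v|
    <= 2 * eps * (l1 u + l1 v) ^+ 2.
Proof.
move=> H eps0 uvd.
have seg (x : R) : 0 <= x <= 1 -> l1 (u + x *: v) <= l1 u + l1 v.
  move=> /andP[x0 x1]; rewrite (le_trans (le_l1D _ _))// lerD2l l1Z ger0_norm //.
  by rewrite ler_piMl // l1_ge0.
have seg' (x : R) : 0 <= x <= 1 -> l1 (x *: v) <= l1 u + l1 v.
  move=> /andP[x0 x1]; rewrite l1Z ger0_norm // (@le_trans _ _ (l1 v)) //.
    by rewrite ler_piMl // l1_ge0.
  by rewrite lerDr l1_ge0.
have [x x01|x x01] := @MVT_unit (fun y => g (t + u + y *: v) - g (t + y *: v))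
    (fun y => 'D_v g (t + u + y *: v) - 'D_v g (t + y *: v)).
  apply: is_deriveB; apply: is_derive_line.
    by rewrite -addrA; have [] := H _ (le_lt_trans (seg _ x01) uvd).
  by have [] := H _ (le_lt_trans (seg' _ x01) uvd).
rewrite !scale1r !scale0r !addr0 => E.
have [_ /(_ v) H1] := H _ (le_lt_trans (seg _ x01) uvd).
have [_ /(_ v) H2] := H _ (le_lt_trans (seg' _ x01) uvd).
rewrite addrA hessDl in H1.
have {}H1 := le_trans H1 (_ : _ <= eps * (l1 u + l1 v) ^+ 2).
have {}H2 := le_trans H2 (_ : _ <= eps * (l1 u + l1 v) ^+ 2).
have lv : l1 v <= l1 u + l1 v by rewrite lerDr l1_ge0.
rewrite (_ : _ - _ - _ - _ =
  ('D_v g (t + u + x *: v) - 'D_v g t - (hess g t u v + hess g t (x *: v) v))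
  - ('D_v g (t + x *: v) - 'D_v g t - hess g t (x *: v) v)); last by lra.
rewrite (le_trans (ler_normB _ _)) //.
rewrite -mulrA mulr_natl mulr2n lerD ?H1 ?H2 //.
  by rewrite expr2 mulrA ler_pM ?l1_ge0 ?mulr_ge0 ?(ltW eps0) ?l1_ge0 //
    ler_pM2l // seg.
by rewrite expr2 mulrA ler_pM ?l1_ge0 ?mulr_ge0 ?(ltW eps0) ?l1_ge0 // ler_pM2l // seg'.
Qed.

(** Schwarz's theorem: the second difference is symmetric in [u] and [v], hence so
    is its leading term.  The estimate of [second_difference], applied to [s u] and
    [s v], is homogeneous of degree 2 in [s], which is why a single small [s]
    suffices for each [eps]. *)
Lemma hess_sym g t : twice_differentiable g t ->
  forall u v, hess g t u v = hess g t v u.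
Proof.
move=> dg u v; apply/eqP; rewrite -subr_eq0 -normr_le0 leNgt; apply/negP => d0.
set d := `|_| in d0; set K := l1 u + l1 v.
have K0 : 0 <= K by rewrite addr_ge0 ?l1_ge0.
(* The two estimates give [s^2 d <= 4 eps (s K)^2], hence [d <= 4 eps K^2 < d] for
   this [eps]. *)
pose eps := d / (8 * (K ^+ 2 + 1)).
have K21 : 0 < K ^+ 2 + 1 by rewrite ltr_wpDl ?sqr_ge0.
have eps0 : 0 < eps by rewrite divr_gt0 // mulr_gt0.
have [delta delta0 H] := derive_expansion_l1 dg eps0.
pose s := delta / (2 * (K + 1)).
have K1 : 0 < K + 1 by rewrite ltr_wpDl.
have s0 : 0 < s by rewrite divr_gt0 // mulr_gt0.
have sK : s * K < delta.
  rewrite /s -mulrA gtr_pMr // ltr_pdivrMl ?mulr_gt0 // mulr1; lra.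
have lK u' v' : l1 (s *: u') + l1 (s *: v') = s * (l1 u' + l1 v').
  by rewrite !l1Z gtr0_norm // mulrDr.
have := second_difference (u := s *: u) (v := s *: v) H eps0.
have := second_difference (u := s *: v) (v := s *: u) H eps0.
rewrite !lK (addrC (l1 v)) -/K => /(_ sK) H1 /(_ sK) H2.
rewrite !hessZl !hessZr in H1 H2.
have : s ^+ 2 * d <= s ^+ 2 * (4 * eps * K ^+ 2).
  rewrite -{1}(ger0_norm (sqr_ge0 s)) /d -normrM.
  rewrite (_ : _ * (_ - _) =
   (g (t + s *: v + s *: u) - g (t + s *: v) - (g (t + s *: u) - g t)
      - s * (s * hess g t v u))
    - (g (t + s *: u + s *: v) - g (t + s *: u) - (g (t + s *: v) - g t)
      - s * (s * hess g t u v))).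
    rewrite (le_trans (ler_normB _ _)) // (le_trans (lerD H1 H2)) //.
    by rewrite exprMn; lra.
  by rewrite (addrAC t (s *: v)); ring.
rewrite ler_pM2l ?exprn_gt0 // /eps leNgt => /negP; apply.
rewrite [ltLHS](_ : _ = d * (K ^+ 2 / (2 * (K ^+ 2 + 1)))); last first.
  by field; rewrite gt_eqF.
rewrite gtr_pMr // ltr_pdivrMr ?mulr_gt0 // mul1r.
have := sqr_ge0 K; lra.
Qed.

(** A Taylor expansion with a remainder controlled on differences of two points:
    subtracting the quadratic part, the mean value theorem on the segment from [b]
    to [a] reduces the claim to the expansion of ['D_(a - b) g] at a point of that
    segment.  The quadratic part differentiates to [hess g t h (a - b)] only
    because the Hessian is symmetric. *)
Lemma taylor2 g t : twice_differentiable g t ->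
  forall eps : R, 0 < eps -> exists2 delta : R, 0 < delta &
  forall a b, l1 a < delta -> l1 b < delta ->
   `|g (t + a) - g (t + b) - 'D_(a - b) g t
       - 2^-1 * (hess g t a a - hess g t b b)|
   <= eps * (l1 a + l1 b) * l1 (a - b).
Proof.
move=> dg eps eps0; have [delta delta0 H] := derive_expansion_l1 dg eps0.
exists delta => // a b ad bd; set k := a - b.
have seg (x : R) : 0 <= x <= 1 ->
    l1 (b + x *: k) < delta /\ l1 (b + x *: k) <= l1 a + l1 b.
  move=> /andP[x0 x1].
  have -> : b + x *: k = x *: a + (1 - x) *: b.
    by rewrite /k scalerBr scalerBl scale1r addrCA.
  have := le_l1D (x *: a) ((1 - x) *: b).
  rewrite !l1Z ger0_norm // ger0_norm ?subr_ge0 // => L.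
  have conv m : l1 a <= m -> l1 b <= m -> l1 (x *: a + (1 - x) *: b) <= m.
    move=> am bm; have := ler_wpM2l x0 am.
    have : (1 - x) * l1 b <= (1 - x) * m by rewrite ler_wpM2l ?subr_ge0.
    by move: L; lra.
  split; last by apply: conv; rewrite (lerDl, lerDr) l1_ge0.
  apply: (le_lt_trans (y := Num.max (l1 a) (l1 b))); last by rewrite gt_max ad bd.
  by apply: conv; rewrite le_max lexx ?orbT.
(* Along the segment, the linear and quadratic parts are [y A + y^2 B] up to a
   constant. *)
pose A := 'D_k g t + hess g t b k; pose B := 2^-1 * hess g t k k.
have [x x01|x x01] := @MVT_unit (fun y => g (t + b + y *: k) - (y * A + y ^+ 2 * B))
    (fun y => 'D_k g (t + b + y *: k) - (A + 2 * y * B)).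
  apply: is_deriveB; first apply: is_derive_line.
    by rewrite -addrA; have [] := H _ (seg _ x01).1.
  exact: is_derive_quadratic.
rewrite scale1r scale0r addr0 expr1n expr0n /= !mul1r !mul0r addr0 subr0.
have -> : t + b + k = t + a by rewrite -addrA (addrC b) subrK.
move=> E.
have -> : g (t + a) - g (t + b) - 'D_k g t - 2^-1 * (hess g t a a - hess g t b b)
    = 'D_k g (t + (b + x *: k)) - 'D_k g t - hess g t (b + x *: k) k.
  have ha : hess g t a a - hess g t b b = hess g t b k + hess g t b k + hess g t k k.
    have -> : a = b + k by rewrite /k addrC subrK.
    clearbody k; by rewrite hessDl !hessDr (hess_sym dg k b); ring.
  rewrite ha hessDl hessZl addrA; move: E; rewrite /A /B. lra.
have [/H[_ /(_ k) Hk] lex] := seg _ x01.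
rewrite (le_trans Hk) // ler_wpM2r ?l1_ge0 // ler_pM2l //.
Qed.

Lemma hess_le g t : exists2 M : R, 0 <= M &
  forall u v, `|hess g t u v| <= M * (l1 u * l1 v).
Proof.
exists (\sum_i \sum_j `|'D_(dir i) ('D_(dir j) g) t|) => [|u v].
  by apply: sumr_ge0 => i _; exact: sumr_ge0.
rewrite mulr_suml (le_trans (ler_norm_sum _ _ _))//; apply: ler_sum => i _.
rewrite mulr_suml (le_trans (ler_norm_sum _ _ _))//; apply: ler_sum => j _.
by rewrite !normrM mulrC ler_wpM2l // ler_pM // le_entry_l1.
Qed.

(** Strict differentiability at [t], obtained from [taylor2] since the quadratic
    part is a product of [l1 a + l1 b], which is small, and [l1 (a - b)]. *)
Lemma taylor1 g t : twice_differentiable g t ->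
  forall eps : R, 0 < eps -> exists2 delta : R, 0 < delta &
  forall a b, l1 a < delta -> l1 b < delta ->
   `|g (t + a) - g (t + b) - 'D_(a - b) g t| <= eps * l1 (a - b).
Proof.
move=> dg eps eps0; have [delta delta0 H] := taylor2 dg ltr01.
have [M M0 HM] := hess_le g t.
have M1 : 0 < 2 * (1 + M) by rewrite mulr_gt0 // ltr_wpDr.
exists (Num.min delta (eps / (2 * (1 + M)))).
  by rewrite lt_min delta0 divr_gt0.
move=> a b; rewrite !lt_min => /andP[ad ae] /andP[bd be].
have := H a b ad bd; set T := g (t + a) - _ - _ => HT.
have hE : hess g t a a - hess g t b b = hess g t (a - b) a + hess g t b (a - b).
  by rewrite hessDl hessDr hessNl hessNr; ring.
rewrite -[T](subrK (2^-1 * (hess g t a a - hess g t b b))).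
rewrite (le_trans (ler_normD _ _)) //.
have : `|hess g t a a - hess g t b b| <= M * ((l1 a + l1 b) * l1 (a - b)).
  rewrite hE (le_trans (ler_normD _ _)) // (le_trans (lerD (HM _ _) (HM _ _))) //.
  by rewrite (mulrC (l1 (a - b))) -mulrDr -mulrDl.
rewrite normrM (ger0_norm (x := 2^-1)) //.
have : (1 + M) * (l1 a + l1 b) <= eps.
  have Me x : x < eps / (2 * (1 + M)) -> (1 + M) * x <= eps / 2.
    by rewrite ltr_pdivlMr // => xe; lra.
  by have := Me _ ae; have := Me _ be; lra.
move=> /(ler_wpM2r (l1_ge0 (a - b))).
move: HT; set K := l1 (a - b); set S := l1 a + l1 b => HT.
have KS : 0 <= S * K by rewrite mulr_ge0 ?addr_ge0 ?l1_ge0.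
have MKS : 0 <= M * (S * K) by rewrite mulr_ge0.
lra.
Qed.
End Calculus.

(** * Words of directions and multi-indices *)

Section Jets.
Context {R : realType} {d1 d2 : nat}.
Local Notation param := ('cV[R]_d1 * 'M[R]_d2)%type.
Local Notation idx := ('I_d1 + 'I_d2 * 'I_d2)%type.
Local Notation mi := (@multi_index d1 d2).
Implicit Types (g : param -> R) (t : param) (s : seq idx).

(** A jet index is an ordered word of at most two directions.  Words keep the
    Taylor coefficients simple; a multi-index is a word up to permutation. *)
Definition jet : Type := (unit + idx + idx * idx)%type.

Definition word (j : jet) : seq idx :=
  match j with
  | inl (inl _) => [::]
  | inl (inr p) => [:: p]
  | inr pq => [:: pq.1; pq.2]
  end.

Definition Dword s g : param -> R := foldr (fun p h => 'D_(dir p) h) g s.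

Definition mi_of s : mi :=
  (\col_i inord (count_mem (inl i : idx) s),
   \matrix_(i, j) inord (count_mem (inr (i, j) : idx) s)).

(** The directions in the order in which [partial] differentiates, outermost
    first. *)
Definition idx_enum : seq idx :=
  [seq inl i | i <- enum 'I_d1] ++ [seq inr ij | ij <- enum {: 'I_d2 * 'I_d2}].

Lemma size_word j : (size (word j) <= 2)%N.
Proof. by case: j => [[[]|p]|pq]. Qed.

Lemma count_small s p : (size s <= 2)%N -> (count_mem p s < 3)%N.
Proof. by rewrite ltnS; apply: leq_trans; exact: count_size. Qed.

Lemma sumn_count s : (\sum_p count_mem p s = size s)%N.
Proof.
elim: s => [|x s IH] /=; first by rewrite big1.
rewrite big_split /= IH (bigD1 x) //= eqxx big1 => [|p]; first by rewrite addn0.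
by rewrite eq_sym => /negbTE ->.
Qed.

Lemma order_mi_of s : (size s <= 2)%N -> order_mi (mi_of s) = size s.
Proof.
move=> s2; rewrite -[RHS]sumn_count big_sumType /order_mi /=.
congr addn; first by apply: eq_bigr => i _; rewrite mxE inordK // count_small.
rewrite pair_big /=; apply: eq_bigr => -[i j] _.
by rewrite mxE inordK // count_small.
Qed.

(** Both sides say that the two words have the same number of occurrences of each
    direction. *)
Lemma mi_of_eq s s' : (size s <= 2)%N -> (size s' <= 2)%N ->
  (mi_of s == mi_of s') = perm_eq s s'.
Proof.
move=> s2 s'2; apply/eqP/idP => [[/matrixP E1 /matrixP E2]|/permP E]; last first.
  by congr pair; apply/matrixP => i j; rewrite !mxE E.
apply/allP => -[i|[i j]] _ /=; apply/eqP.
  by have := E1 i 0; rewrite !mxE => /(congr1 val); rewrite /= !inordK ?count_small.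
by have := E2 i j; rewrite !mxE => /(congr1 val); rewrite /= !inordK ?count_small.
Qed.

Lemma idx_enum_uniq : uniq idx_enum.
Proof.
rewrite cat_uniq; apply/and3P; split.
- by rewrite map_inj_uniq ?enum_uniq // => ? ? [].
- by apply/hasPn => _ /mapP[ij _ ->]; apply/mapP => -[i _].
- by rewrite map_inj_uniq ?enum_uniq // => ? ? [].
Qed.

Lemma mem_idx_enum p : p \in idx_enum.
Proof.
by case: p => p; rewrite mem_cat; apply/orP; [left|right];
  apply/mapP; exists p; rewrite // mem_enum.
Qed.

(** [partial] applies the directions of the multi-index in the fixed order
    [idx_enum], so it computes the derivative along a sorted version of the
    word. *)
Lemma partial_mi_of s g : (size s <= 2)%N ->
  exists2 s', perm_eq s' s & partial (mi_of s) g = Dword s' g.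
Proof.
move=> s2; pose w := flatten [seq nseq (count_mem p s) p | p <- idx_enum].
exists w.
  apply/allP => p _ /=; apply/eqP; rewrite count_flatten -map_comp sumnE big_map.
  rewrite (bigD1_seq p) ?mem_idx_enum ?idx_enum_uniq //= count_nseq /= eqxx mul1n.
  by rewrite big1 ?addn0 // => q qp; rewrite count_nseq /= (negbTE qp) mul0n.
rewrite /w /idx_enum map_cat flatten_cat /Dword foldr_cat.
have foldF (T : Type) (i : T -> idx) (r : seq T) h :
    foldr (fun p h => 'D_(dir p) h) h
      (flatten [seq nseq (count_mem p s) p | p <- [seq i x | x <- r]])
    = foldr (fun x => iter (count_mem (i x) s) (fun h => 'D_(dir (i x)) h)) h r.
  elim: r => //= x r IH; rewrite foldr_cat IH.
  by elim: (count_mem _ _) => //= n ->.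
rewrite !foldF /partial /=; congr foldr; last congr foldr.
- by apply/funext => i; rewrite mxE inordK ?count_small.
- by apply/funext => -[i j]; rewrite mxE inordK ?count_small.
Qed.

Lemma perm_eq_le2 (T : eqType) (s s' : seq T) : (size s <= 2)%N -> perm_eq s' s ->
  s' = s \/ s' = rev s.
Proof.
case: s => [|x [|y [|]]] //= _.
- by move/(@perm_small_eq _ _ [::] isT); left.
- by move/(@perm_small_eq _ _ [:: x] isT); left.
case: s' => [|a [|b [|c s']]] E; have //= := perm_size E => _.
have : a \in [:: x; y] by rewrite -(perm_mem E) mem_head.
rewrite !inE => /orP[|] /eqP aE; subst a.
  by move: E; rewrite perm_cons => /(@perm_small_eq _ _ [:: y] isT)[->]; left.
have : perm_eq [:: y; b] [:: y; x] by rewrite (perm_trans E) // (perm_catC [:: x]).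
by rewrite perm_cons => /(@perm_small_eq _ _ [:: x] isT)[->]; right.
Qed.

Lemma sum_entry_dir (H : idx -> idx -> R) p q :
  \sum_i \sum_j entry i (dir p) * entry j (dir q) * H i j = H p q.
Proof.
rewrite (bigD1 p) //= (bigD1 q) //= !entry_dir !eqxx !mul1r.
rewrite [X in _ + X + _]big1 => [|j jq].
  rewrite big1 ?addr0 // => i ip.
  by rewrite big1 // => j _; rewrite entry_dir (negbTE ip) !mul0r.
by rewrite !entry_dir (negbTE jq) mulr0 mul0r.
Qed.

Lemma hess_dir g t p q :
  hess g t (dir p) (dir q) = 'D_(dir p) ('D_(dir q) g) t.
Proof. exact: (sum_entry_dir (fun i j => 'D_(dir i) ('D_(dir j) g) t)). Qed.

Lemma Dword_rev j g t : twice_differentiable g t ->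
  Dword (rev (word j)) g t = Dword (word j) g t.
Proof.
case: j => [[u|p]|[p q]] dg; [exact: erefl|exact: erefl|].
have := hess_sym dg (dir q) (dir p).
rewrite !hess_dir; exact.
Qed.

Lemma partial_word j g t : twice_differentiable g t ->
  partial (mi_of (word j)) g t = Dword (word j) g t.
Proof.
move=> dg; have [s' s's ->] := partial_mi_of g (size_word j).
have [->|->] := perm_eq_le2 (size_word j) s's; first exact: erefl.
exact: Dword_rev.
Qed.

(** Strong identifiability, restated for words.  A word and its reversal give the
    same derivative, so only coefficients that are symmetric under permutation of
    words can be recovered: the coefficient of a multi-index is a positive
    multiple of the common coefficient of the words that represent it. *)
Lemma jets_independent (d : nat) (X : set (Rd R d))
    (Theta : set 'cV[R]_d1) (Omega : set 'M[R]_d2) (f : Rd R d -> param -> R)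
    (k : nat) (tau : 'I_k -> param) (c : 'I_k -> jet -> R) :
  strongly_identifiable2 X Theta Omega f ->
  injective tau -> (forall i, (Theta `*` Omega) (tau i)) ->
  (forall i j j', perm_eq (word j) (word j') -> c i j = c i j') ->
  {ae lebesgue_Rd R d, forall x, X x ->
     \sum_i \sum_j c i j * Dword (word j) (f x) (tau i) = 0} ->
  forall i j, c i j = 0.
Proof.
move=> [df ident] tau_inj Ktau csym c0 i j.
have k0 : (0 < k)%N by apply: leq_trans (ltn_ord i).
(* Gather the coefficients of all the words that represent [eta]. *)
pose alpha i eta := \sum_j (eta == mi_of (word j))%:R * c i j.
have a0 : alpha i (mi_of (word j)) = 0.
  apply: (ident k tau) => //; last by rewrite order_mi_of // size_word.
  apply: filterS c0 => x c0 Xx; rewrite -[RHS](c0 Xx).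
  pose T i' j' (eta : mi) :=
    (eta == mi_of (word j'))%:R * (c i' j' * partial eta (f x) (tau i')).
  transitivity (\sum_i' \sum_j' \sum_(l < 3)
      \sum_(eta | order_mi eta == l) T i' j' eta).
    symmetry.
    under eq_bigr => i' _ do rewrite exchange_big /=.
    rewrite exchange_big /=; apply: eq_bigr => l _.
    under eq_bigr => i' _ do rewrite exchange_big /=.
    rewrite exchange_big /=; apply: eq_bigr => eta _; apply: eq_bigr => i' _.
    by rewrite mulr_suml; apply: eq_bigr => j' _; rewrite /T mulrA.
  apply: eq_bigr => i' _; apply: eq_bigr => j' _.
  rewrite (bigD1 (Ordinal (size_word j' : (size (word j') < 3)%N))) //=.
  rewrite (bigD1 (mi_of (word j'))) ?order_mi_of ?size_word //=.
  rewrite /T eqxx mul1r partial_word; last exact: df.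
  rewrite big1 => [|eta /andP[_ /negbTE ->]]; last by rewrite mul0r.
  rewrite big1 ?addr0 // => l lj; rewrite big1 // => eta /eqP etal.
  rewrite [_ == _](_ : _ = false) ?mul0r //; apply/eqP => E.
  by move/eqP: lj; apply; apply: val_inj; rewrite /= -etal E order_mi_of ?size_word.
move: a0; rewrite /alpha (eq_bigr (fun j' => (perm_eq (word j) (word j'))%:R * c i j)).
  rewrite -mulr_suml => /eqP; rewrite mulf_eq0 => /orP[|/eqP //].
  rewrite (bigD1 j) //= perm_refl paddr_eq0 ?oner_eq0 //.
  by apply: sumr_ge0.
move=> j' _; rewrite mi_of_eq ?size_word //.
by case: (boolP (perm_eq _ _)) => [/csym ->|]; rewrite ?mul0r.
Qed.
End Jets.

(** * Subsequences and Fatou's lemma *)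

Lemma near_subseq (phi : nat -> nat) (P : nat -> Prop) :
  (forall k, (k <= phi k)%N) -> (\forall n \near \oo, P n) ->
  \forall k \near \oo, P (phi k).
Proof.
move=> lephi [m _ Pm]; exists m => // k /= mk.
by apply: Pm; exact: leq_trans mk (lephi k).
Qed.

(** The extraction is required to satisfy [k <= phi k] instead of being increasing:
    this makes it a bare choice of points near the cluster point, and it is enough
    for passing to the limit. *)
Lemma compact_subseq (R : realType) (T : pseudoMetricType R) (K : set T)
    (x : nat -> T) : compact K -> (forall n, K (x n)) ->
  exists p (phi : nat -> nat), [/\ K p, forall k, (k <= phi k)%N &
    x (phi k) @[k --> \oo] --> p].
Proof.
move=> Kco Kx.
have [|p [Kp clp]] := Kco (x n @[n --> \oo]) _.
  by exists 0%N => // n _; exact: Kx.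
have /choice[phi phiP] : forall k, exists n, (k <= n)%N /\ ball p k.+1%:R^-1 (x n).
  move=> k; have k0 : 0 < k.+1%:R^-1 :> R by rewrite invr_gt0.
  have [|_ [[n kn <-] pn]] := clp (x @` [set n | (k <= n)%N])
      (ball p k.+1%:R^-1) _ (nbhsx_ballx _ _ k0); last by exists n.
    by exists k => // n /= kn; exists n.
exists p, phi; split => // [k|]; first by have [] := phiP k.
apply/cvg_ballP => e e0; near=> k.
have [_] := phiP k; apply: le_ball; apply/ltW.
by near: k; exact: near_infty_natSinv_lt (PosNum e0).
Unshelve. all: by end_near.
Qed.

Section Fatou.
Context {R : realType} {dsp : measure_display} {T : measurableType dsp}.
Variables (mu : {measure set T -> \bar R}) (X : set T) (mX : measurable X).
Variables (J : finType) (phi : J -> T -> R).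
Variables (F : nat -> T -> R) (c : nat -> J -> R) (eps : nat -> R).
Let N n : R := \sum_j `|c n j|.

(** Compactness of the cube: normalized coefficients have a convergent subsequence,
    whose limit still has l1 norm 1.  Equalities between coefficients pass to the
    limit. *)
Lemma bounded_family_subseq : (forall n, 0 < N n) ->
  exists (u : J -> R) (nu : nat -> nat), [/\ forall k, (k <= nu k)%N,
    forall j, c (nu k) j / N (nu k) @[k --> \oo] --> u j,
    exists j, u j != 0 &
    forall j j', (forall n, c n j = c n j') -> u j = u j'].
Proof.
move=> N0.
pose x n : 'rV[R]_#|J| := \row_i (c n (enum_val i) / N n).
have xE n j : x n 0 (enum_rank j) = c n j / N n by rewrite mxE enum_rankK.
have x1 n i : x n 0 i \in `[-1, 1].
  rewrite mxE in_itv /= -ler_norml normrM normfV (gtr0_norm (N0 n)).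
  by rewrite ler_pdivrMr // mul1r /N (bigD1 (enum_val i)) //= lerDl sumr_ge0.
have Kco : compact [set v : 'rV[R]_#|J| | forall i, `[(-1 : R), 1]%classic (v 0 i)].
  apply: (@rV_compact R _ (fun=> `[(-1 : R), 1]%classic)) => _; exact: segment_compact.
have [p [nu [_ nuP xp]]] := compact_subseq Kco x1.
have cu j : c (nu k) j / N (nu k) @[k --> \oo] --> p 0 (enum_rank j).
  rewrite (_ : (fun k => _) = (fun M : 'rV[R]_#|J| => M 0 (enum_rank j)) \o (x \o nu)).
    by apply: cvg_comp xp _; exact: coord_continuous.
  by apply/funext => k; rewrite /= xE.
exists (fun j => p 0 (enum_rank j)), nu; split => //.
- apply/not_existsP => u0.
  have : \sum_j `|c (nu k) j / N (nu k)| @[k --> \oo] --> \sum_j `|p 0 (enum_rank j)|.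
    by apply: cvg_big => [|j _]; [exact: add_continuous|apply: cvg_norm; exact: cu].
  rewrite big1 => [|j _]; last by apply/eqP; rewrite normr_eq0; apply/negPn/negP/u0.
  rewrite (_ : (fun k => _) = fun=> 1).
    move/cvg_lim => /(_ (@Rhausdorff _)); rewrite lim_cst // => /eqP.
    by rewrite oner_eq0.
  apply/funext => k; rewrite (eq_bigr (fun j => `|c (nu k) j| * (N (nu k))^-1)).
    by rewrite -mulr_suml -/(N (nu k)) divff // gt_eqF // N0.
  by move=> j _; rewrite normrM normfV (gtr0_norm (N0 _)).
- move=> j j' E; apply: (cvg_unique (@Rhausdorff R) (cu j)).
  have -> : (fun k => c (nu k) j / N (nu k)) = (fun k => c (nu k) j' / N (nu k)).
    by apply/funext => k; rewrite E.
  exact: cu.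
Qed.

(** After division by [N n], the functions [F n] converge pointwise along a
    subsequence to the combination [sum_j u j * phi j], while their integrals tend
    to 0; by Fatou's lemma the limit vanishes almost everywhere. *)
Lemma fatou_family :
  (forall n, measurable_fun X (F n)) -> (forall n, 0 < N n) ->
  (forall x, X x -> forall e, 0 < e -> \forall n \near \oo,
     `|F n x - \sum_j c n j * phi j x| <= e * N n) ->
  (forall n, (\int[mu]_(x in X) `|F n x|%:E <= (eps n * N n)%:E)%E) ->
  eps n @[n --> \oo] --> 0 ->
  exists u : J -> R, [/\ exists j, u j != 0,
    forall j j', (forall n, c n j = c n j') -> u j = u j' &
    {ae mu, forall x, X x -> \sum_j u j * phi j x = 0}].
Proof.
move=> mF N0 FE intF eps0.
have [u [nu [nuP cu u0 usym]]] := bounded_family_subseq N0.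
exists u; split => //.
pose g x : R := \sum_j u j * phi j x.
pose h k x : \bar R := (`|F (nu k) x / N (nu k)|)%:E.
have epsnu : eps (nu k) @[k --> \oo] --> 0.
  apply: cvg_trans eps0 => P; exact: near_subseq.
have hg x : X x -> h k x @[k --> \oo] --> `|g x|%:E.
  move=> Xx; apply: cvg_EFin; first by near=> k.
  apply: cvg_norm.
  have cg : \sum_j (c (nu k) j / N (nu k)) * phi j x @[k --> \oo] --> g x.
    apply: cvg_big => [|j _]; first exact: add_continuous.
    by apply: cvgM; [exact: cu|exact: cvg_cst].
  apply: cvg_sub0 cg.
  apply/cvgrPdist_le => e e0.
  have := near_subseq nuP (FE x Xx e e0); apply: filterS => k.
  rewrite sub0r normrN !fctE.
  rewrite (_ : \sum_j c (nu k) j / N (nu k) * phi j x =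
      (\sum_j c (nu k) j * phi j x) / N (nu k)); last first.
    by rewrite mulr_suml; apply: eq_bigr => j _; rewrite mulrAC.
  by rewrite -mulrBl normrM normfV (gtr0_norm (N0 _)) ler_pdivrMr.
have mh k : measurable_fun X (h k).
  apply/measurable_EFinP; apply: measurableT_comp => //.
  by apply: measurable_funM => //; exact: measurable_cst.
have mg : measurable_fun X (fun x : T => `|g x|%:E : \bar R).
  exact: (emeasurable_fun_cvg h).
have ih k : (0 <= \int[mu]_(x in X) h k x <= (eps (nu k))%:E)%E.
  apply/andP; split; first by apply: integral_ge0 => x _; rewrite lee_fin.
  rewrite (eq_integral (fun x => ((N (nu k))^-1%:E * `|F (nu k) x|%:E)%E)); last first.
    by move=> x _; rewrite /h normrM normfV (gtr0_norm (N0 _)) mulrC EFinM.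
  rewrite ge0_integralZl //; last 2 first.
  - by apply/measurable_EFinP; apply: measurableT_comp.
  - by rewrite lee_fin invr_ge0 ltW.
  apply: (@le_trans _ _ ((N (nu k))^-1%:E * (eps (nu k) * N (nu k))%:E)%E).
    by rewrite lee_pmul2l // lte_fin invr_gt0.
  by rewrite -EFinM mulrC mulfK // gt_eqF.
have ig : (\int[mu]_(x in X) `|g x|%:E = 0)%E.
  apply/eqP; rewrite eq_le; apply/andP; split; last first.
    by apply: integral_ge0 => x _; rewrite lee_fin.
  have lim0 : (\int[mu]_(x in X) h k x)%E @[k --> \oo] --> 0%E.
    apply: (@squeeze_cvge _ _ _ _ (cst 0%E) _ (fun k => (eps (nu k))%:E)).
    - by apply: nearW => k; exact: ih.
    - exact: cvg_cst.
    - by apply: cvg_EFin epsnu; near=> k.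
  have := fatou mu mX mh; rewrite (cvg_limn_einf_sup lim0).1.
  rewrite (eq_integral (fun x => `|g x|%:E)); first by apply => k x _; rewrite lee_fin.
  by move=> x /set_mem Xx; rewrite (cvg_limn_einf_sup (hg x Xx)).1.
have /ae_eq_integral_abs : (\int[mu]_(x in X) `| `|g x|%:E | = 0)%E.
  by rewrite -[RHS]ig; apply: eq_integral => x _; rewrite gee0_abs // lee_fin.
move=> /(_ mX mg); apply: filterS => x /[apply] /= [[]] /eqP.
by rewrite normr_eq0 => /eqP.
Unshelve. all: by end_near.
Qed.
End Fatou.

(** * Inequalities for the discrepancy *)

Section Moments.
Context {R : realType} {d1 d2 : nat}.
Local Notation param := ('cV[R]_d1 * 'M[R]_d2)%type.
Local Notation idx := ('I_d1 + 'I_d2 * 'I_d2)%type.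
Implicit Types (a b : param) (l k : R).

(** The discrepancy of two mixtures with weights [l], [k] and parameters [t0 + a],
    [t0 + b], where the Euclidean norm is replaced by the l1 norm. *)
Definition disc l k a b : R :=
  l * l1 a ^+ 2 + k * l1 b ^+ 2 - Num.min l k * (l1 a ^+ 2 + l1 b ^+ 2)
  + (l * l1 a + k * l1 b) * l1 (a - b).

Lemma normE_le m n (A : 'M[R]_(m, n)) : normE A <= \sum_i \sum_j `|A i j|.
Proof.
have S0 (I : finType) (F : I -> R) : \sum_i `|F i| ^+ 2 <= (\sum_i `|F i|) ^+ 2.
  rewrite expr2 mulr_suml; apply: ler_sum => i _.
  by rewrite expr2 ler_wpM2l // (bigD1 i) //= lerDl sumr_ge0.
have S1 : 0 <= \sum_i \sum_j `|A i j| by apply: sumr_ge0 => i _; exact: sumr_ge0.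
rewrite -[leRHS]ger0_norm // -sqrtr_sqr /normE ler_sqrt ?sqr_ge0 //.
rewrite pair_big /= [in leRHS]pair_big /=.
apply: le_trans (S0 _ (fun ij : 'I_m * 'I_n => A ij.1 ij.2)).
by apply: ler_sum => ij _; rewrite real_normK // num_real.
Qed.

Lemma normP_le_l1 a : normP a <= l1 a.
Proof.
have n0 m n (A : 'M[R]_(m, n)) : 0 <= normE A by exact: sqrtr_ge0.
have sl : normE a.1 + normE a.2 <= l1 a.
  rewrite /l1 big_sumType /=; apply: lerD; apply: le_trans (normE_le _) _.
    by apply: ler_sum => i _; rewrite big_ord1.
  by rewrite pair_big.
apply: le_trans sl; rewrite -[leRHS]ger0_norm ?addr_ge0 // -sqrtr_sqr.
rewrite ler_sqrt ?sqr_ge0 //.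
by rewrite sqrrD -addrA lerD2l lerDr mulrn_wge0 // mulr_ge0.
Qed.

(** The discrepancy is a combination of norms with nonnegative coefficients, since
    the minimum of the two weights is at most each of them. *)
Lemma discrepancy_le_disc (t0 : param) (G Gs : R * param) : 0 <= G.1 -> 0 <= Gs.1 ->
  discrepancy t0 G Gs <= disc G.1 Gs.1 (G.2 - t0) (Gs.2 - t0).
Proof.
case: G Gs => [l s] [k t] /= l0 k0; rewrite /discrepancy /disc /=.
have -> : s - t0 - (t - t0) = s - t by rewrite opprB addrA subrK.
have n0 (u : param) : 0 <= normP u by exact: sqrtr_ge0.
have := normP_le_l1 (s - t); have := normP_le_l1 (t - t0); have := normP_le_l1 (s - t0).
have := n0 (s - t); have := n0 (t - t0); have := n0 (s - t0).
move: (normP (s - t0)) (normP (t - t0)) (normP (s - t)) => r q w.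
move: (l1 (s - t0)) (l1 (t - t0)) (l1 (s - t)) => r' q' w' r0 q0 w0 rr qq ww.
have r2 : r ^+ 2 <= r' ^+ 2 by rewrite ler_pXn2r // nnegrE (le_trans r0).
have q2 : q ^+ 2 <= q' ^+ 2 by rewrite ler_pXn2r // nnegrE (le_trans q0).
apply: lerD; last first.
  apply: ler_pM => //; first by rewrite addr_ge0 ?mulr_ge0.
  by rewrite lerD // ler_wpM2l.
by case: (leP l k) => lk; nra.
Qed.

Lemma disc_swap l k a b : disc l k a b = disc k l b a.
Proof.
by rewrite /disc minC -(l1N (a - b)) opprB; ring.
Qed.

Lemma disc_le l k a b : l <= k ->
  disc l k a b = (k - l) * l1 b ^+ 2 + (l * l1 a + k * l1 b) * l1 (a - b).
Proof. by move=> lk; rewrite /disc min_l //; ring. Qed.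

Lemma l1_tensor a b : \sum_p \sum_q `|entry p a * entry q b| = l1 a * l1 b.
Proof.
rewrite mulr_suml; apply: eq_bigr => p _; rewrite mulr_sumr.
by apply: eq_bigr => q _; rewrite normrM.
Qed.

(** With [U] and [W] the l1 norms of the first and second moments, [H1] and [H2]
    bound the products of the weights with [l1 (a - b)] and [H3] bounds the excess
    of weight, as explained at the top of the file. *)
Lemma disc_moments_le l k a b (B : R) : 0 <= l -> l <= k -> l1 a <= B -> l1 b <= B ->
  disc l k a b <= (6 + 4 * B) *
    (\sum_p `|l * entry p a - k * entry p b| + 2^-1 * \sum_p \sum_q
       `|l * entry p a * entry q a - k * entry p b * entry q b|).
Proof.
move=> l0 lk aB bB; rewrite disc_le //.
set W := \sum_p \sum_q _; set U := \sum_p _.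
have k0 := le_trans l0 lk.
have A0 := l1_ge0 a; have B0 := l1_ge0 b; have D0 := l1_ge0 (a - b).
have U0 : 0 <= U by exact: sumr_ge0.
have W0 : 0 <= W by apply: sumr_ge0 => p _; exact: sumr_ge0.
(* In the two uses below, the hypothesis says that the tensor [s u(x)v] is
   [M2 - M1(x)w]. *)
have tensor s u v w : 0 <= s ->
    (forall p q, s * (entry p u * entry q v) =
      (l * entry p a * entry q a - k * entry p b * entry q b)
       - (l * entry p a - k * entry p b) * entry q w) ->
    s * (l1 u * l1 v) <= W + U * l1 w.
  move=> s0 E; rewrite -l1_tensor mulr_sumr /W /U mulr_suml -big_split.
  apply: ler_sum => p _; rewrite mulr_sumr /l1 mulr_sumr -big_split /=.
  apply: ler_sum => q _; rewrite -{1}(ger0_norm s0) -normrM E.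
  by rewrite (le_trans (ler_normB _ _)) // normrM.
have H1 : k * (l1 b * l1 (a - b)) <= W + U * l1 a.
  by apply: tensor => // p q; rewrite entryB; ring.
have H2 : l * (l1 a * l1 (a - b)) <= W + U * l1 b.
  by apply: tensor => // p q; rewrite entryB; ring.
have H3 : (k - l) * l1 b <= l * l1 (a - b) + U.
  rewrite !mulr_sumr -big_split; apply: ler_sum => p _ /=.
  rewrite -{1}(ger0_norm (_ : 0 <= k - l)) ?subr_ge0 // -normrM.
  have -> : (k - l) * entry p b =
      l * entry p (a - b) - (l * entry p a - k * entry p b) by rewrite entryB; ring.
  by rewrite (le_trans (ler_normB _ _)) // normrM (ger0_norm l0).
have H4 := ler_wpM2r B0 H3.
have H5 : l * l1 (a - b) * l1 b <= k * l1 (a - b) * l1 b.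
  by rewrite ler_wpM2r // ler_wpM2r.
have H6 := ler_wpM2l U0 aB; have H7 := ler_wpM2l U0 bB.
have H8 : 0 <= B * W by rewrite mulr_ge0 // (le_trans A0).
nra.
Qed.

Lemma disc_moments l k a b (B : R) : 0 <= l -> 0 <= k -> l1 a <= B -> l1 b <= B ->
  disc l k a b <= (6 + 4 * B) *
    (\sum_p `|l * entry p a - k * entry p b| + 2^-1 * \sum_p \sum_q
       `|l * entry p a * entry q a - k * entry p b * entry q b|).
Proof.
move=> l0 k0 aB bB; have [lk|/ltW kl] := leP l k; first exact: disc_moments_le.
rewrite disc_swap (le_trans (disc_moments_le k0 kl bB aB)) // le_eqVlt; apply/orP; left.
apply/eqP; congr (_ * (_ + _ * _)); apply: eq_bigr => p _; first exact: distrC.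
by apply: eq_bigr => q _; exact: distrC.
Qed.

(** Here [ga] and [gb] stand for Taylor remainders at [t0 + a] and [t0 + b].  For
    [l <= k], writing [l ga - k gb = l (ga - gb) - (k - l) gb] matches the two terms
    of [disc_le]. *)
Lemma disc_remainder l k a b (eps ga gb : R) : 0 <= l -> 0 <= k -> 0 <= eps ->
  `|ga - gb| <= eps * (l1 a + l1 b) * l1 (a - b) ->
  `|ga| <= eps * l1 a ^+ 2 -> `|gb| <= eps * l1 b ^+ 2 ->
  `|l * ga - k * gb| <= eps * disc l k a b.
Proof.
move=> l0 k0 eps0.
wlog lk : l k a b ga gb l0 k0 / l <= k => [wlg|] Hab Ha Hb.
  have [lk|/ltW kl] := leP l k; first exact: wlg.
  rewrite disc_swap distrC; apply: wlg => //.
  by rewrite distrC (addrC (l1 b)) -(l1N (b - a)) opprB.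
rewrite disc_le // (_ : _ - _ = l * (ga - gb) - (k - l) * gb); last by ring.
have kl0 : 0 <= k - l by rewrite subr_ge0.
rewrite (le_trans (ler_normB _ _)) // !normrM (ger0_norm l0) (ger0_norm kl0).
have H1 := ler_wpM2l l0 Hab; have H2 := ler_wpM2l kl0 Hb.
have H3 : l * (l1 b * l1 (a - b)) <= k * (l1 b * l1 (a - b)).
  by rewrite ler_wpM2r // mulr_ge0 ?l1_ge0.
have H4 := ler_wpM2l eps0 H3.
lra.
Qed.

(** For parameters with a common limit different from [t0]: the mixtures are then
    told apart by the increment [l * l1 (a - b)] and the difference of weights. *)
Lemma disc_le_increment l k a b (B : R) :
  0 <= l -> 0 <= k -> l1 a <= B -> l1 b <= B ->
  disc l k a b <= (3 * B ^+ 2 + 2 * B) * (`|k - l| + l * l1 (a - b)).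
Proof.
have key (x y A A' D : R) : 0 <= x -> x <= y -> 0 <= A -> A <= B ->
    0 <= A' -> A' <= B -> 0 <= D -> D <= 2 * B ->
    (y - x) * A' ^+ 2 + (x * A + y * A') * D
      <= (3 * B ^+ 2 + 2 * B) * (y - x + x * D).
  move=> x0 xy A0 AB A'0 A'B D0 DB.
  have yx0 : 0 <= y - x by rewrite subr_ge0.
  have B0 := le_trans A0 AB.
  have A'2 : A' ^+ 2 <= B ^+ 2 by rewrite ler_pXn2r // nnegrE.
  have H1 := ler_wpM2l yx0 A'2.
  have xD0 : 0 <= x * D by rewrite mulr_ge0.
  have H2 := ler_wpM2l xD0 AB; have H3 := ler_wpM2l xD0 A'B.
  have H4 : A' * D <= B * (2 * B) by rewrite ler_pM.
  have {}H4 := ler_wpM2l yx0 H4.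
  have H5 : 0 <= B ^+ 2 * (x * D) by rewrite mulr_ge0 ?sqr_ge0.
  have H6 : 0 <= B * (y - x) by rewrite mulr_ge0.
  lra.
move=> l0 k0 aB bB.
have DB : l1 (a - b) <= 2 * B.
  by rewrite (le_trans (le_l1D _ _)) // l1N; lra.
have [lk|kl] := leP l k.
  by rewrite disc_le // ger0_norm ?subr_ge0 // key ?l1_ge0.
rewrite disc_swap disc_le ?(ltW kl) // distrC ger0_norm ?subr_ge0 ?(ltW kl) //.
rewrite -(l1N (b - a)) opprB.
rewrite (le_trans (key _ _ _ _ _ k0 (ltW kl) _ bB _ aB _ DB)) ?l1_ge0 //.
have B0 := le_trans (l1_ge0 a) aB.
apply: ler_wpM2l; first by rewrite addr_ge0 ?mulr_ge0 ?sqr_ge0.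
by rewrite lerD2l ler_wpM2r ?l1_ge0 // ltW.
Qed.

(** For [t0 + b] away from [t0] and from [t0 + a]: the weight [k] is then visible
    by itself, and [l] at least through [l * l1 a]. *)
Lemma disc_le_far l k a b (B : R) :
  0 <= l -> 0 <= k -> l1 a <= B -> l1 b <= B ->
  disc l k a b <= (3 * B ^+ 2 + 3 * B) * (k + l * l1 a).
Proof.
move=> l0 k0 aB bB.
have A0 := l1_ge0 a; have B0 := l1_ge0 b; have D0 := l1_ge0 (a - b).
have DB : l1 (a - b) <= 2 * B.
  by rewrite (le_trans (le_l1D _ _)) // l1N; lra.
have A2 : l1 a ^+ 2 <= B * l1 a by rewrite expr2 ler_wpM2r.
have B2 : l1 b ^+ 2 <= B ^+ 2 by rewrite ler_pXn2r // nnegrE (le_trans B0).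
have Bd0 : 0 <= B := le_trans A0 aB.
have m0 : 0 <= Num.min l k * (l1 a ^+ 2 + l1 b ^+ 2).
  by rewrite mulr_ge0 ?addr_ge0 ?sqr_ge0 // le_min l0.
have H1 := ler_wpM2l l0 A2; have H2 := ler_wpM2l k0 B2.
have lA0 : 0 <= l * l1 a by rewrite mulr_ge0.
have H3 := ler_wpM2l lA0 DB.
have kb : k * l1 b <= k * B by rewrite ler_wpM2l.
have H4 := ler_wpM2l (mulr_ge0 k0 B0) DB.
have H5 := ler_wpM2r (mulr_ge0 (ler0n R 2) Bd0) kb.
have H6 : 0 <= B ^+ 2 * (l * l1 a) by rewrite mulr_ge0 ?sqr_ge0.
have H7 : 0 <= B * k by rewrite mulr_ge0.
rewrite /disc; lra.
Qed.
End Moments.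

(** * Lower bounds for integrals of jets *)

Section LowerBounds.
Context {R : realType} {d d1 d2 : nat}.
Local Notation param := ('cV[R]_d1 * 'M[R]_d2)%type.
Local Notation idx := ('I_d1 + 'I_d2 * 'I_d2)%type.
Local Notation jet := (@jet d1 d2).
Variables (X : set (Rd R d)) (mX : measurable X).
Variables (Theta : set 'cV[R]_d1) (Omega : set 'M[R]_d2).
Variable f : Rd R d -> param -> R.
Hypothesis f_ident : strongly_identifiable2 X Theta Omega f.
Local Notation mu := (lebesgue_Rd R d).

Let df x t : X x -> (Theta `*` Omega) t -> twice_differentiable (f x) t.
Proof. by have [+ _] := f_ident; apply. Qed.

Lemma sum_jet (V : nmodType) (F : jet -> V) :
  \sum_j F j = F (inl (inl tt)) + \sum_p F (inl (inr p)) + \sum_p \sum_q F (inr (p, q)).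
Proof.
rewrite big_sumType /= big_sumType /=; congr (_ + _ + _).
  by rewrite (bigD1 tt) //= big1 ?addr0 // => -[].
by rewrite pair_big; apply: eq_bigr => -[].
Qed.

(** [D] is the quantity to be bounded in terms of the integrals of [|F n|]; it is
    compared with the size of the coefficients through the constant [C]. *)
Lemma jets_lower_bound (k : nat) (tau : 'I_k -> param)
    (c : nat -> 'I_k -> jet -> R) (F : nat -> Rd R d -> R) (D eps : nat -> R) (C : R) :
  injective tau -> (forall i, (Theta `*` Omega) (tau i)) ->
  (forall n i j j', perm_eq (word j) (word j') -> c n i j = c n i j') ->
  (forall n, 0 < D n) -> (forall n, D n <= C * \sum_i \sum_j `|c n i j|) ->
  (forall n, measurable_fun X (F n)) ->
  (forall x, X x -> forall e, 0 < e -> \forall n \near \oo,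
     `|F n x - \sum_i \sum_j c n i j * Dword (word j) (f x) (tau i)|
       <= e * \sum_i \sum_j `|c n i j|) ->
  (forall n, 0 <= eps n) ->
  (forall n, (\int[mu]_(x in X) `|F n x|%:E <= (eps n * D n)%:E)%E) ->
  eps n @[n --> \oo] --> 0 ->
  False.
Proof.
move=> tau_inj Ktau csym D0 DC mF Fc epsn0 intF eps0.
have [C0 c0] : 0 < C /\ forall n, 0 < \sum_i \sum_j `|c n i j|.
  have CS n : 0 < C * \sum_i \sum_j `|c n i j| := lt_le_trans (D0 n) (DC n).
  have S0 n : 0 <= \sum_i \sum_j `|c n i j|.
    by apply: sumr_ge0 => i _; exact: sumr_ge0.
  have C0 : 0 < C.
    by rewrite ltNge; apply/negP => C0; have := CS 0%N; rewrite ltNge mulr_le0_ge0.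
  by split => // n; have := CS n; rewrite pmulr_rgt0.
have Ceps0 : C * eps n @[n --> \oo] --> 0.
  by rewrite -(mulr0 C); apply: cvgM => //; exact: cvg_cst.
pose c' n (ij : 'I_k * jet) := c n ij.1 ij.2.
pose phi (ij : 'I_k * jet) x := Dword (word ij.2) (f x) (tau ij.1).
have c'E n : \sum_ij `|c' n ij| = \sum_i \sum_j `|c n i j|.
  by rewrite pair_big.
have phiE n x : \sum_ij c' n ij * phi ij x =
    \sum_i \sum_j c n i j * Dword (word j) (f x) (tau i).
  by rewrite pair_big.
have [|||u [[ij u0] usym u_ae]] :=
  @fatou_family R _ _ mu X mX _ phi F c' _ mF _ _ _ Ceps0.
- by move=> n; rewrite c'E.
- by move=> x Xx e e0; have := Fc x Xx e e0; apply: filterS => n; rewrite c'E phiE.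
- move=> n; apply: le_trans (intF n) _; rewrite c'E lee_fin (mulrC C) -mulrA.
  by rewrite ler_wpM2l.
have /eqP := u0; apply; rewrite (surjective_pairing ij).
apply: (jets_independent (c := fun i j => u (i, j)) f_ident tau_inj Ktau).
  by move=> i j j' jj'; apply: usym => n; exact: csym.
apply: filterS u_ae => x ux Xx; rewrite -[RHS](ux Xx) pair_big.
by apply: eq_bigr => -[].
Qed.

Lemma near_l1 (y : nat -> param) (tau : param) (e : R) : 0 < e ->
  y n @[n --> \oo] --> tau -> \forall n \near \oo, l1 (y n - tau) < e.
Proof.
move=> e0 /cvgrPdist_lt/(_ (e / (#|{: idx}|%:R + 1)))[|N _ HN].
  by rewrite divr_gt0 // ltr_wpDl.
exists N => // n /HN; rewrite distrC ltr_pdivlMr ?ltr_wpDl //.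
by apply: le_lt_trans; rewrite (le_trans (l1_le_norm _)) // mulrC ler_wpM2l // lerDl.
Qed.

(** Each limit point [tau i] carries a mass [m i] and a dipole [l i] between [z i]
    and [y i], which the expansion of [f x] at [tau i] turns into a value and a
    first derivative in the direction [y i - z i]. *)
Lemma first_order_lower_bound (k : nat) (tau : 'I_k -> param)
    (y z : nat -> 'I_k -> param) (l m : nat -> 'I_k -> R)
    (F : nat -> Rd R d -> R) (D eps : nat -> R) (C : R) :
  injective tau -> (forall i, (Theta `*` Omega) (tau i)) ->
  (forall i, y n i @[n --> \oo] --> tau i) ->
  (forall i, z n i @[n --> \oo] --> tau i) ->
  (forall n, 0 < D n) ->
  (forall n, D n <= C * \sum_i (`|m n i| + `|l n i| * l1 (y n i - z n i))) ->
  (forall n, measurable_fun X (F n)) ->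
  (forall n x, X x -> F n x =
     \sum_i (m n i * f x (z n i) + l n i * (f x (y n i) - f x (z n i)))) ->
  (forall n, 0 <= eps n) ->
  (forall n, (\int[mu]_(x in X) `|F n x|%:E <= (eps n * D n)%:E)%E) ->
  eps n @[n --> \oo] --> 0 ->
  False.
Proof.
move=> tau_inj Ktau ytau ztau D0 DC mF FE epsn0 intF eps0.
pose c n i (j : jet) := match j with
  | inl (inl _) => m n i
  | inl (inr p) => l n i * entry p (y n i - z n i)
  | inr _ => 0
  end.
have cE n : \sum_i \sum_j `|c n i j| =
    \sum_i (`|m n i| + `|l n i| * l1 (y n i - z n i)).
  apply: eq_bigr => i _; rewrite sum_jet /= [X in _ + X]big1 ?addr0.
    by congr (_ + _); rewrite mulr_sumr; apply: eq_bigr => p _; rewrite normrM.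
  by move=> p _; rewrite big1 // => q _; rewrite normr0.
have cphiE n i x : X x -> \sum_j c n i j * Dword (word j) (f x) (tau i) =
    m n i * f x (tau i) + l n i * 'D_(y n i - z n i) (f x) (tau i).
  move=> Xx; rewrite sum_jet /= [X in _ + X]big1 ?addr0.
    have [dfx _] := df Xx (Ktau i).
    rewrite (derive_entry _ (nbhs_singleton dfx)) mulr_sumr; congr (_ + _).
    by apply: eq_bigr => p _; rewrite mulrA.
  by move=> p _; rewrite big1 // => q _; rewrite mul0r.
apply: (@jets_lower_bound k tau c F D eps C) => //.
- move=> n i [[[]|p]|[p q]] [[[]|p']|[p' q']] //= pp'; try by have := perm_size pp'.
  by have [->] := @perm_small_eq _ _ [:: p'] isT pp'.
- by move=> n; rewrite cE.
- move=> x Xx e e0.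
  have near_i (i : 'I_k) : \forall n \near \oo,
      `|f x (z n i) - f x (tau i)| <= e /\
      `|f x (y n i) - f x (z n i) - 'D_(y n i - z n i) (f x) (tau i)|
        <= e * l1 (y n i - z n i).
    have [dfx _] := df Xx (Ktau i).
    have [delta delta0 H] := taylor1 (df Xx (Ktau i)) e0.
    have fc : {for tau i, continuous (f x)}.
      by apply: differentiable_continuous; exact: nbhs_singleton dfx.
    near=> n; split.
      rewrite distrC; near: n.
      have /cvgrPdist_le := cvg_comp _ _ (ztau i) fc; exact.
    have := H (y n i - tau i) (z n i - tau i).
    have -> : y n i - tau i - (z n i - tau i) = y n i - z n i.
      by rewrite opprB addrA subrK.
    rewrite !(addrC (tau i)) !subrK; apply.
      by near: n; exact: near_l1.
    by near: n; exact: near_l1.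
  have : \forall n \near \oo, forall i : 'I_k,
      `|f x (z n i) - f x (tau i)| <= e /\
      `|f x (y n i) - f x (z n i) - 'D_(y n i - z n i) (f x) (tau i)|
        <= e * l1 (y n i - z n i).
    by apply: filter_forall => i; exact: near_i.
  apply: filterS => n H; rewrite cE FE // -sumrB.
  rewrite mulr_sumr (le_trans (ler_norm_sum _ _ _)) //; apply: ler_sum => i _.
  rewrite cphiE // opprD addrACA -!mulrBr (le_trans (ler_normD _ _)) // !normrM.
  have [H1 H2] := H i.
  rewrite mulrDr lerD //; first by rewrite mulrC ler_wpM2r.
  by rewrite mulrCA ler_wpM2l.
Unshelve. all: by end_near.
Qed.

(** Here every point tends to [t0], and the value [f x t0] cancels: the
    coefficients are, up to a factor 1/2, the first two moments of the signed
    measure [l delta_y - k delta_z] recentred at [t0]. *)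
Lemma second_order_lower_bound (t0 : param) (y z : nat -> param) (l k : nat -> R)
    (F : nat -> Rd R d -> R) (eps : nat -> R) (B : R) :
  (Theta `*` Omega) t0 ->
  y n @[n --> \oo] --> t0 -> z n @[n --> \oo] --> t0 ->
  (forall n, l1 (y n - t0) <= B) -> (forall n, l1 (z n - t0) <= B) ->
  (forall n, 0 <= l n) -> (forall n, 0 <= k n) -> (forall n, 0 <= eps n) ->
  (forall n, 0 < disc (l n) (k n) (y n - t0) (z n - t0)) ->
  (forall n, measurable_fun X (F n)) ->
  (forall n x, X x -> F n x =
     l n * (f x (y n) - f x t0) - k n * (f x (z n) - f x t0)) ->
  (forall n, (\int[mu]_(x in X) `|F n x|%:E
     <= (eps n * disc (l n) (k n) (y n - t0) (z n - t0))%:E)%E) ->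
  eps n @[n --> \oo] --> 0 ->
  False.
Proof.
move=> Kt0 yt0 zt0 yB zB l0 k0 epsn0 D0 mF FE intF eps0.
pose a n := y n - t0; pose b n := z n - t0.
pose c n (i : 'I_1) (j : jet) := match j with
  | inl (inl _) => 0
  | inl (inr p) => l n * entry p (a n) - k n * entry p (b n)
  | inr pq => 2^-1 * (l n * entry pq.1 (a n) * entry pq.2 (a n)
                      - k n * entry pq.1 (b n) * entry pq.2 (b n))
  end.
pose C := 6 + 4 * B.
have B0 : 0 <= B := le_trans (l1_ge0 _) (yB 0%N).
have C0 : 0 < C by rewrite /C; lra.
have cE n : \sum_i \sum_j `|c n i j| =
    \sum_p `|l n * entry p (a n) - k n * entry p (b n)| + 2^-1 * \sum_p \sum_q
     `|l n * entry p (a n) * entry q (a n) - k n * entry p (b n) * entry q (b n)|.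
  rewrite big_ord1 sum_jet /= normr0 add0r; congr (_ + _).
  rewrite mulr_sumr; apply: eq_bigr => p _; rewrite mulr_sumr; apply: eq_bigr => q _.
  by rewrite normrM ger0_norm.
have DN n : disc (l n) (k n) (a n) (b n) <= C * \sum_i \sum_j `|c n i j|.
  by rewrite cE; apply: disc_moments; [exact: l0|exact: k0|exact: yB|exact: zB].
have cphiE n x : X x -> \sum_i \sum_j c n i j * Dword (word j) (f x) t0 =
    l n * ('D_(a n) (f x) t0 + 2^-1 * hess (f x) t0 (a n) (a n))
    - k n * ('D_(b n) (f x) t0 + 2^-1 * hess (f x) t0 (b n) (b n)).
  move=> Xx; have [/nbhs_singleton dfx _] := df Xx Kt0.
  rewrite big_ord1 sum_jet /= mul0r add0r !(derive_entry _ dfx).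
  rewrite !mulrDr opprD addrACA; congr (_ + _).
    rewrite !mulr_sumr -sumrB; apply: eq_bigr => p _; rewrite /Dword /=; ring.
  rewrite /hess !mulr_sumr -sumrB; apply: eq_bigr => p _.
  rewrite !mulr_sumr -sumrB; apply: eq_bigr => q _; rewrite /Dword /=; ring.
apply: (@jets_lower_bound 1 (fun=> t0) c F _ eps C _ _ _ D0 DN) => //.
- by move=> i j _; rewrite !ord1.
- move=> n i [[[]|p]|[p q]] [[[]|p']|[p' q']] //= pp'; try by have := perm_size pp'.
    by have [->] := @perm_small_eq _ _ [:: p'] isT pp'.
  have [[-> ->] //|] := @perm_eq_le2 _ [:: p'; q'] [:: p; q] isT pp'.
  by rewrite /rev /= => -[-> ->]; congr (_ * (_ - _)); rewrite mulrAC.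
- move=> x Xx e e0.
  have eC : 0 < e / C by rewrite divr_gt0.
  have [delta delta0 H] := taylor2 (df Xx Kt0) eC.
  near=> n.
  have ad : l1 (a n) < delta by near: n; exact: near_l1.
  have bd : l1 (b n) < delta by near: n; exact: near_l1.
  pose g u := f x (t0 + u) - f x t0 - ('D_u (f x) t0 + 2^-1 * hess (f x) t0 u u).
  have [/nbhs_singleton dfx _] := df Xx Kt0.
  have h0 : hess (f x) t0 0 0 = 0 by rewrite -(scale0r 0) hessZl mul0r.
  have l10 : l1 (0 : param) = 0 by rewrite -(scale0r 0) l1Z normr0 mul0r.
  have g0 u : l1 u < delta -> `|g u| <= e / C * l1 u ^+ 2.
    move=> ud; have := H u 0 ud; rewrite l10 => /(_ delta0).
    rewrite !addr0 subr0 h0 subr0 expr2 mulrA /g opprD addrA; exact.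
  have gab : `|g (a n) - g (b n)| <= e / C * (l1 (a n) + l1 (b n)) * l1 (a n - b n).
    have := H (a n) (b n) ad bd.
    have -> : 'D_(a n - b n) (f x) t0 = 'D_(a n) (f x) t0 - 'D_(b n) (f x) t0.
      by rewrite !deriveE // linearB.
    apply: le_trans; rewrite le_eqVlt; apply/orP; left; apply/eqP; congr `|_|.
    have alg (p q r u v u' v' : R) :
      p - q - (u - v) - 2^-1 * (u' - v') =
      p - r - (u + 2^-1 * u') - (q - r - (v + 2^-1 * v')) by ring.
    exact: esym (alg _ _ _ _ _ _ _).
  have := disc_remainder (l0 n) (k0 n) (ltW eC) gab (g0 _ ad) (g0 _ bd).
  have -> : l n * g (a n) - k n * g (b n) =
    F n x - \sum_i \sum_j c n i j * Dword (word j) (f x) t0.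
    have alg (l' k' p q r u v : R) :
      l' * (p - r - u) - k' * (q - r - v) =
      l' * (p - r) - k' * (q - r) - (l' * u - k' * v).
      by ring.
    by rewrite FE // cphiE // /g alg !(addrC t0) !subrK.
  move=> /le_trans; apply.
  by rewrite -mulrA ler_pM2l // mulrC ler_pdivrMr // mulrC.
Unshelve. all: by end_near.
Qed.
End LowerBounds.

(** * The limit points of a degenerating sequence *)

Section Cases.
Context {R : realType} {d d1 d2 : nat}.
Local Notation param := ('cV[R]_d1 * 'M[R]_d2)%type.
Variables (X : set (Rd R d)) (mX : measurable X).
Variables (Theta : set 'cV[R]_d1) (Omega : set 'M[R]_d2).
Variable f : Rd R d -> param -> R.
Hypothesis f_ident : strongly_identifiable2 X Theta Omega f.
Local Notation mu := (lebesgue_Rd R d).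

(** The five positions of the limits [tau] and [taus] with respect to [t0] and to
    each other.  Outside the case [tau = taus = t0], the function [F n] is written
    as masses and dipoles at the distinct limit points. *)
Lemma no_degenerating_sequence (t0 tau taus : param) (y z : nat -> param)
    (l k : nat -> R) (F : nat -> Rd R d -> R) (eps : nat -> R) (B : R) :
  (Theta `*` Omega) t0 -> (Theta `*` Omega) tau -> (Theta `*` Omega) taus ->
  y n @[n --> \oo] --> tau -> z n @[n --> \oo] --> taus ->
  (forall n, l1 (y n - t0) <= B) -> (forall n, l1 (z n - t0) <= B) ->
  (forall n, 0 <= l n) -> (forall n, 0 <= k n) ->
  (forall n, 0 < disc (l n) (k n) (y n - t0) (z n - t0)) ->
  (forall n, measurable_fun X (F n)) ->
  (forall n x, X x -> F n x =
     l n * (f x (y n) - f x t0) - k n * (f x (z n) - f x t0)) ->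
  (forall n, 0 <= eps n) ->
  (forall n, (\int[mu]_(x in X) `|F n x|%:E
     <= (eps n * disc (l n) (k n) (y n - t0) (z n - t0))%:E)%E) ->
  eps n @[n --> \oo] --> 0 ->
  False.
Proof.
move=> Kt0 Ktau Ktaus ytau ztaus yB zB l0 k0 D0 mF FE epsn0 intF eps0.
have B0 : 0 <= B := le_trans (l1_ge0 _) (yB 0%N).
have inj_nth (s : seq param) : uniq s -> injective (fun i : 'I_(size s) => nth t0 s i).
  by move=> us i j /eqP; rewrite nth_uniq // => /eqP /val_inj.
have subE a b : a - t0 - (b - t0) = a - b by rewrite opprB addrA subrK.
have cst_cvg : (fun=> t0) n @[n --> \oo] --> t0 by exact: cvg_cst.
have [taut0|taut0] := eqVneq tau t0; have [taust0|taust0] := eqVneq taus t0.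
- rewrite taut0 in ytau; rewrite taust0 in ztaus.
  exact: (second_order_lower_bound mX f_ident Kt0 ytau ztaus yB zB l0 k0 epsn0
    D0 mF FE intF eps0).
(* [F n = k f(t0) + l (f(y) - f(t0)) - k f(z)] *)
- pose ts := [:: t0; taus].
  apply: (@first_order_lower_bound _ _ _ _ X mX Theta Omega f f_ident 2
    (fun i => nth t0 ts i) (fun n i => nth t0 [:: y n; z n] i)
    (fun n i => nth t0 [:: t0; z n] i) (fun n i => nth 0 [:: l n; 0] i)
    (fun n i => nth 0 [:: k n; - k n] i) F _ eps (3 * B ^+ 2 + 3 * B) _ _ _ _ D0).
  + by apply: (inj_nth ts); rewrite /= inE eq_sym taust0.
  + by case=> [[|[|]]].
  + by rewrite taut0 in ytau; case=> [[|[|]]].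
  + by case=> [[|[|]]].
  + move=> n; rewrite !big_ord_recl big_ord0 /=.
    apply: le_trans (disc_le_far (l0 n) (k0 n) (yB n) (zB n)) _.
    rewrite normr0 mul0r !addr0 normrN !ger0_norm //.
    by rewrite ler_wpM2l ?addr_ge0 ?mulr_ge0 ?sqr_ge0 // lerDl.
  + exact: mF.
  + by move=> n x Xx; rewrite FE // !big_ord_recl big_ord0 /=; ring.
  + exact: epsn0.
  + exact: intF.
  + exact: eps0.
(* [F n = - l f(t0) - k (f(z) - f(t0)) + l f(y)] *)
- pose ts := [:: t0; tau].
  apply: (@first_order_lower_bound _ _ _ _ X mX Theta Omega f f_ident 2
    (fun i => nth t0 ts i) (fun n i => nth t0 [:: z n; y n] i)
    (fun n i => nth t0 [:: t0; y n] i) (fun n i => nth 0 [:: - k n; 0] i)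
    (fun n i => nth 0 [:: - l n; l n] i) F _ eps (3 * B ^+ 2 + 3 * B) _ _ _ _ D0).
  + by apply: (inj_nth ts); rewrite /= inE eq_sym taut0.
  + by case=> [[|[|]]].
  + by rewrite taust0 in ztaus; case=> [[|[|]]].
  + by case=> [[|[|]]].
  + move=> n; rewrite !big_ord_recl big_ord0 /= disc_swap.
    apply: le_trans (disc_le_far (k0 n) (l0 n) (zB n) (yB n)) _.
    rewrite normr0 mul0r !addr0 !normrN !ger0_norm //.
    by rewrite ler_wpM2l ?addr_ge0 ?mulr_ge0 ?sqr_ge0 // lerDl.
  + exact: mF.
  + by move=> n x Xx; rewrite FE // !big_ord_recl big_ord0 /=; ring.
  + exact: epsn0.
  + exact: intF.
  + exact: eps0.
have [tauE|tau_neq] := eqVneq tau taus.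
(* [F n = (k - l) f(t0) + (l - k) f(z) + l (f(y) - f(z))] *)
- pose ts := [:: t0; tau].
  apply: (@first_order_lower_bound _ _ _ _ X mX Theta Omega f f_ident 2
    (fun i => nth t0 ts i) (fun n i => nth t0 [:: t0; y n] i)
    (fun n i => nth t0 [:: t0; z n] i) (fun n i => nth 0 [:: 0; l n] i)
    (fun n i => nth 0 [:: k n - l n; l n - k n] i) F _ eps
    (3 * B ^+ 2 + 2 * B) _ _ _ _ D0).
  + by apply: (inj_nth ts); rewrite /= inE eq_sym taut0.
  + by case=> [[|[|]]].
  + by case=> [[|[|]]].
  + by rewrite -tauE in ztaus; case=> [[|[|]]].
  + move=> n; rewrite !big_ord_recl big_ord0 /=.
    apply: le_trans (disc_le_increment (l0 n) (k0 n) (yB n) (zB n)) _.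
    rewrite normr0 mul0r !addr0 subE (ger0_norm (l0 n)).
    by rewrite ler_wpM2l ?addr_ge0 ?mulr_ge0 ?sqr_ge0 // lerD2l lerDr.
  + exact: mF.
  + by move=> n x Xx; rewrite FE // !big_ord_recl big_ord0 /=; ring.
  + exact: epsn0.
  + exact: intF.
  + exact: eps0.
(* [F n = (k - l) f(t0) + l f(y) - k f(z)] *)
pose ts := [:: t0; tau; taus].
apply: (@first_order_lower_bound _ _ _ _ X mX Theta Omega f f_ident 3
  (fun i => nth t0 ts i) (fun n i => nth t0 [:: t0; y n; z n] i)
  (fun n i => nth t0 [:: t0; y n; z n] i) (fun=> fun=> 0)
  (fun n i => nth 0 [:: k n - l n; l n; - k n] i) F _ eps
  ((3 * B ^+ 2 + 3 * B) * (1 + B)) _ _ _ _ D0).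
+ by apply: (inj_nth ts); rewrite /= !inE negb_or !(eq_sym t0) taut0 taust0 tau_neq.
+ by case=> [[|[|[|]]]].
+ by case=> [[|[|[|]]]].
+ by case=> [[|[|[|]]]].
+ move=> n; rewrite !big_ord_recl big_ord0 /=.
  apply: le_trans (disc_le_far (l0 n) (k0 n) (yB n) (zB n)) _.
  rewrite normr0 !mul0r !addr0 normrN (ger0_norm (l0 n)) (ger0_norm (k0 n)) -mulrA.
  apply: ler_wpM2l; first by rewrite addr_ge0 ?mulr_ge0 ?sqr_ge0.
  have := ler_wpM2l (l0 n) (yB n); have := normr_ge0 (k n - l n).
  have := mulr_ge0 B0 (normr_ge0 (k n - l n)).
  have := mulr_ge0 B0 (k0 n); have := l0 n; lra.
+ exact: mF.
+ by move=> n x Xx; rewrite FE // !big_ord_recl big_ord0 /=; ring.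
+ exact: epsn0.
+ exact: intF.
+ exact: eps0.
Qed.
End Cases.

(** * The lower bound *)

Lemma l1_bounded {R : realType} {d1 d2 : nat}
    (K : set ('cV[R]_d1 * 'M[R]_d2)) (t0 : 'cV[R]_d1 * 'M[R]_d2) :
  compact K -> exists B : R, forall t, K t -> l1 (t - t0) <= B.
Proof.
move=> /compact_bounded[M [_ KM]].
exists (#|{: 'I_d1 + 'I_d2 * 'I_d2}|%:R * (M + 1 + `|t0|)) => t Kt.
rewrite (le_trans (l1_le_norm _)) // ler_wpM2l //.
by rewrite (le_trans (ler_normB _ _)) // lerD2r; apply: KM; rewrite ?ltrDl.
Qed.

Lemma measurable_mixture {R : realType} {d d1 d2 : nat} (X : set (Rd R d))
    (h0 : Rd R d -> R) (f : Rd R d -> 'cV[R]_d1 * 'M[R]_d2 -> R) G :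
  measurable_fun X h0 -> measurable_fun X (fun x => f x G.2) ->
  measurable_fun X (mixture h0 f G).
Proof.
move=> mh0 mf.
by apply: measurable_funD; apply: measurable_funM => //; exact: measurable_cst.
Qed.

Theorem theorem3p5 (R : realType) (d d1 d2 : nat)
    (X : set (Rd R d)) (mX : measurable X)
    (Theta : set 'cV[R]_d1) (Omega : set 'M[R]_d2)
    (Theta_compact : compact Theta) (Omega_compact : compact Omega)
    (Omega_posdef : forall S, Omega S -> posdef S)
    (f : Rd R d -> 'cV[R]_d1 * 'M[R]_d2 -> R)
    (f_density : forall t, (Theta `*` Omega) t -> is_density X (fun x => f x t))
    (mu0 : 'cV[R]_d1) (Sigma0 : 'M[R]_d2)
    (Theta_mu0 : Theta mu0) (Omega_Sigma0 : Omega Sigma0)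
    (h0 : Rd R d -> R) (h0E : forall x, X x -> h0 x = f x (mu0, Sigma0))
    (f_ident : strongly_identifiable2 X Theta Omega f)
    (f_lip : uniform_lipschitz2 X Theta Omega f) :
  exists2 C : R, 0 < C &
    forall G Gs, Xi Theta Omega G -> Xi Theta Omega Gs ->
      ((C * discrepancy (mu0, Sigma0) G Gs)%:E <=
        V X (mixture h0 f G) (mixture h0 f Gs))%E.
Proof.
set t0 := (mu0, Sigma0).
have Kt0 : (Theta `*` Omega) t0 by split.
have mf t : (Theta `*` Omega) t -> measurable_fun X (fun x => f x t).
  by move=> /f_density[].
have mh0 : measurable_fun X h0.
  by apply: eq_measurable_fun (mf _ Kt0) => x /set_mem Xx; rewrite h0E.
have Kco : compact (Theta `*` Omega) by exact: compact_setX.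
have [B KB] := l1_bounded t0 Kco.
apply: contrapT => noC.
have /choice[P PP] : forall n,
    exists P : (R * ('cV[R]_d1 * 'M[R]_d2)) * (R * ('cV[R]_d1 * 'M[R]_d2)),
    [/\ Xi Theta Omega P.1, Xi Theta Omega P.2 &
      (V X (mixture h0 f P.1) (mixture h0 f P.2)
        < (n.+1%:R^-1 * discrepancy t0 P.1 P.2)%:E)%E].
  move=> n; apply: contrapT => noP; apply: noC.
  exists n.+1%:R^-1; first by rewrite invr_gt0.
  move=> G Gs GX GsX; rewrite leNgt; apply/negP => VD.
  by apply: noP; exists (G, Gs).
pose x n := ((P n).1.2, (P n).2.2).
have Kx n : ((Theta `*` Omega) `*` (Theta `*` Omega)) (x n).
  by have [[_ K1] [_ K2] _] := PP n; split.
have [[tau taus] [nu [[/= Ktau Ktaus] nuP xp]]] :=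
  compact_subseq (compact_setX Kco Kco) Kx.
pose G k := (P (nu k)).1; pose Gs k := (P (nu k)).2.
have GX k : Xi Theta Omega (G k) by have [] := PP (nu k).
have GsX k : Xi Theta Omega (Gs k) by have [] := PP (nu k).
pose F k x := mixture h0 f (G k) x - mixture h0 f (Gs k) x.
pose D k := disc (G k).1 (Gs k).1 ((G k).2 - t0) ((Gs k).2 - t0).
have dD k : discrepancy t0 (G k) (Gs k) <= D k.
  have [/andP[G0 _] _] := GX k; have [/andP[Gs0 _] _] := GsX k.
  exact: discrepancy_le_disc.
have VD k : (V X (mixture h0 f (G k)) (mixture h0 f (Gs k))
    < (k.+1%:R^-1 * D k)%:E)%E.
  have [_ _] := PP (nu k); rewrite -/(G k) -/(Gs k) => Vd.
  have d0 : 0 < (nu k).+1%:R^-1 * discrepancy t0 (G k) (Gs k).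
    rewrite -lte_fin; apply: le_lt_trans Vd; apply: mule_ge0; first by rewrite lee_fin.
    by apply: integral_ge0 => u _; rewrite lee_fin.
  move: d0; rewrite pmulr_rgt0 ?invr_gt0 // => d0.
  apply: lt_le_trans Vd _; rewrite lee_fin; apply: ler_pM => //; first exact: ltW.
  by rewrite lef_pV2 ?posrE // ler_nat ltnS.
have D0 k : 0 < D k.
  have : (0 < (k.+1%:R^-1 * D k)%:E)%E.
    apply: le_lt_trans (VD k); apply: mule_ge0; first by rewrite lee_fin.
    by apply: integral_ge0 => u _; rewrite lee_fin.
  by rewrite lte_fin pmulr_rgt0 ?invr_gt0.
(* The factor 2 makes up for the 1/2 in the total variation distance. *)
apply: (@no_degenerating_sequence R d d1 d2 X mX Theta Omega f f_ident t0 tau taus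
  (fun k => (G k).2) (fun k => (Gs k).2) (fun k => (G k).1) (fun k => (Gs k).1)
  F (fun k => 2 * k.+1%:R^-1) B) => //.
- exact: cvg_comp xp (@cvg_fst _ _ _ _ _).
- exact: cvg_comp xp (@cvg_snd _ _ _ _ _).
- by move=> k; apply: KB; have [] := GX k.
- by move=> k; apply: KB; have [] := GsX k.
- by move=> k; have [/andP[]] := GX k.
- by move=> k; have [/andP[]] := GsX k.
- move=> k; apply: measurable_funB; apply: measurable_mixture => //; apply: mf.
    by have [] := GX k.
  by have [] := GsX k.
- by move=> k u Xu; rewrite /F /mixture h0E //; ring.
- move=> k; rewrite -mulrA EFinM.
  rewrite (_ : (\int[_]_(_ in _) _ =
      2%:E * V X (mixture h0 f (G k)) (mixture h0 f (Gs k)))%E).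
    by rewrite lee_pmul2l // ltW // VD.
  by rewrite /V muleA -EFinM divff // mul1e.
- rewrite -(mulr0 2); apply: cvgM; first exact: cvg_cst.
  exact: cvg_harmonic.
Qed.
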